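(* Consider the two-user Gaussian multiple-access wiretap channel without feedback described in the context, with power constraints $P_1,P_2>0$ and noise variances $\sigma_1^2,\sigma_2^2>0$. Its secrecy capacity region $\mathcal{C}_{s,gmac}$ satisfies $\mathcal{C}_{s,gmac}\subseteq\mathcal{C}^{out}_{s,gmac}$, where, writing $M=\max\{\alpha_1P_1,\alpha_2P_2\}$ and $D=\sigma_1^2+\sigma_2^2+M+\beta(P_1+P_2-M)$, \[ \mathcal{C}^{out}_{s,gmac}=\bigcup_{0\le\alpha_1,\alpha_2,\beta\le1}\Big\{(R_1\ge0,R_2\ge0):\ R_1\le\tfrac12\log\Big(1+\tfrac{\alpha_1P_1}{\sigma_1^2}\Big)-\tfrac12\log\Big(\tfrac{D}{\sigma_1^2+\sigma_2^2+\alpha_2P_2}\Big), \] \[ R_2\le\tfrac12\log\Big(1+\tfrac{\alpha_2P_2}{\sigma_1^2}\Big)-\tfrac12\log\Big(\tfrac{D}{\sigma_1^2+\sigma_2^2+\alpha_1P_1}\Big),\ R_1+R_2\le\tfrac12\log\Big(1+\tfrac{P_1+P_2}{\sigma_1^2}\Big)-\tfrac12\log\Big(1+\tfrac{P_1+P_2}{\sigma_1^2+\sigma_2^2}\Big)\Big\}. \]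
   Context: All logarithms are base 2. Channel (GMAC-WT without feedback): for $i=1,\dots,N$, $Y_i=X_{1,i}+X_{2,i}+\eta_{1,i}$ (legitimate receiver) and $Z_i=Y_i+\eta_{2,i}$ (wiretapper), where $\eta_{1,i}\sim\mathcal N(0,\sigma_1^2)$ and $\eta_{2,i}\sim\mathcal N(0,\sigma_2^2)$ are i.i.d. over $i$, mutually independent, and independent of the messages. Messages $W_1,W_2$ are independent, $W_j$ uniform on $\{1,\dots,|\mathcal W_j|\}$. For $j=1,2$, the input $X_{j,i}$ is a (possibly stochastic) function of $W_j$ only, subject to $\frac1N\sum_{i=1}^N E[X_{j,i}^2]\le P_j$. The receiver outputs $(\hat W_1,\hat W_2)=\psi(Y^N)$; $P_e$ is the average probability that $\psi(Y^N)\neq(W_1,W_2)$. The equivocation is $\Delta=\frac1N H(W_1,W_2\mid Z^N)$. A pair $(R_1,R_2)$ is achievable with perfect weak secrecy if for every $\epsilon>0$ and all sufficiently large $N$ there exist encoders and a decoder with $\frac{\log|\mathcal W_j|}{N}=R_j$ ($j=1,2$), $\Delta\ge R_1+R_2-\epsilon$ and $P_e\le\epsilon$. $\mathcal{C}_{s,gmac}$ is the set of all such pairs. *)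

(* Defs.v *)
From HB Require Import structures.
From mathcomp Require Import all_boot all_order all_algebra.
From mathcomp Require Import all_classical all_reals all_analysis.

Set Implicit Arguments.
Unset Strict Implicit.
Unset Printing Implicit Defensive.

Import Order.TTheory GRing.Theory Num.Theory.
Local Open Scope classical_set_scope.
Local Open Scope ring_scope.

Section GMACWT.
Context {R : realType}.

Definition log2 (x : R) : R := ln x / ln 2.

Definition gdens (v x : R) : R :=
  expR (- (x ^+ 2) / (v *+ 2)) / Num.sqrt (pi * v *+ 2).

Definition vcons (n : nat) (x : R) (v : 'I_n -> R) : 'I_n.+1 -> R :=
  fun i => if unlift ord0 i is Some j then v j else x.

Fixpoint lebN (n : nat) : (('I_n -> R) -> R) -> R :=
  match n return (('I_n -> R) -> R) -> R with
  | 0 => fun F => F (fun _ => 0)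
  | n'.+1 => fun F =>
      Rintegral (@lebesgue_measure R) setT (fun x => lebN (fun v => F (vcons x v)))
  end.

Definition cylinders (n : nat) : set (set ('I_n -> R)) :=
  fun A => exists (i : 'I_n) (B : set R), measurable B /\ A = [set v | B (v i)].

Definition Rn_measurable (n : nat) (A : set ('I_n -> R)) : Prop :=
  <<s @cylinders n >> A.

(* Conditional density of the output of an additive Gaussian channel with
   noise variance v, given the messages (w1,w2): averaged over the private
   randomness u1 ~ Q1, u2 ~ Q2 of the two (stochastic) encoders.
   Y^N = X1^N + X2^N + eta1^N  uses v = s1 ;
   Z^N = Y^N + eta2^N = X1^N + X2^N + (eta1^N + eta2^N)  uses v = s1 + s2. *)
Definition out_dens (N M1 M2 : nat) {d1 d2 : measure_display}
  {O1 : measurableType d1} {O2 : measurableType d2}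
  (Q1 : probability O1 R) (Q2 : probability O2 R)
  (enc1 : 'I_M1 -> O1 -> 'I_N -> R) (enc2 : 'I_M2 -> O2 -> 'I_N -> R)
  (v : R) (w1 : 'I_M1) (w2 : 'I_M2) (y : 'I_N -> R) : R :=
  Rintegral Q1 setT (fun u1 => Rintegral Q2 setT (fun u2 =>
    \prod_(i < N) gdens v (y i - enc1 w1 u1 i - enc2 w2 u2 i))).

(* A code of block length N with message sets 'I_M1, 'I_M2 (uniform messages),
   stochastic encoders enc_j(w_j, u_j) with private randomness u_j ~ Q_j,
   decoder dec, meeting rates, power, reliability and secrecy requirements. *)
Definition good_code (P1 P2 s1 s2 R1 R2 eps : R) (N M1 M2 : nat)
  {d1 d2 : measure_display}
  {O1 : measurableType d1} {O2 : measurableType d2}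
  (Q1 : probability O1 R) (Q2 : probability O2 R)
  (enc1 : 'I_M1 -> O1 -> 'I_N -> R) (enc2 : 'I_M2 -> O2 -> 'I_N -> R)
  (dec : ('I_N -> R) -> 'I_M1 * 'I_M2) : Prop :=
  let pY := out_dens Q1 Q2 enc1 enc2 s1 in
  let pZ := out_dens Q1 Q2 enc1 enc2 (s1 + s2) in
  let invM := ((M1 * M2)%N%:R)^-1 in
  [/\ (0 < M1)%N /\ (0 < M2)%N /\
      log2 M1%:R / N%:R = R1 /\ log2 M2%:R / N%:R = R2,
      (forall w i, measurable_fun setT (fun u => enc1 w u i)) /\
      (forall w i, measurable_fun setT (fun u => enc2 w u i)) /\
      (forall m, Rn_measurable (dec @^-1` [set m])),
      (* power constraints: (1/N) sum_i E[X_{j,i}^2] <= P_j *)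
      ((\sum_(w < M1) \int[Q1]_u ((\sum_(i < N) enc1 w u i ^+ 2)%:E))%E
         <= (M1%:R * N%:R * P1)%:E)%E /\
      ((\sum_(w < M2) \int[Q2]_u ((\sum_(i < N) enc2 w u i ^+ 2)%:E))%E
         <= (M2%:R * N%:R * P2)%:E)%E,
      invM * \sum_(w1 < M1) \sum_(w2 < M2)
         lebN (fun y => pY w1 w2 y * (dec y != (w1, w2))%:R) <= eps &
      (* equivocation Delta = (1/N) H(W1,W2 | Z^N) >= R1 + R2 - eps, where
         H(W|Z^N) = sum_w p(w) int p(z|w) (- log2 P(W = w | Z^N = z)) dz *)
      R1 + R2 - eps <= N%:R^-1 * (invM * \sum_(w1 < M1) \sum_(w2 < M2)
         lebN (fun z => pZ w1 w2 z *
           - log2 (invM * pZ w1 w2 z /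
                   (invM * \sum_(v1 < M1) \sum_(v2 < M2) pZ v1 v2 z))))].

Definition achievable_sgmac (P1 P2 s1 s2 : R) (R1 R2 : R) : Prop :=
  forall eps : R, 0 < eps -> exists N0 : nat, forall N : nat, (N0 < N)%N ->
    exists (M1 M2 : nat) (d1 d2 : measure_display)
      (O1 : measurableType d1) (O2 : measurableType d2)
      (Q1 : probability O1 R) (Q2 : probability O2 R)
      (enc1 : 'I_M1 -> O1 -> 'I_N -> R) (enc2 : 'I_M2 -> O2 -> 'I_N -> R)
      (dec : ('I_N -> R) -> 'I_M1 * 'I_M2),
      good_code P1 P2 s1 s2 R1 R2 eps Q1 Q2 enc1 enc2 dec.

Definition C_sgmac (P1 P2 s1 s2 : R) : set (R * R) :=
  [set r | achievable_sgmac P1 P2 s1 s2 r.1 r.2].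

Definition C_out_sgmac (P1 P2 s1 s2 : R) : set (R * R) :=
  [set r | exists a1 a2 b : R,
     [/\ 0 <= a1 <= 1, 0 <= a2 <= 1, 0 <= b <= 1 &
     let M := Num.max (a1 * P1) (a2 * P2) in
     let D := s1 + s2 + M + b * (P1 + P2 - M) in
     [/\ 0 <= r.1, 0 <= r.2,
         r.1 <= 2^-1 * log2 (1 + a1 * P1 / s1)
                - 2^-1 * log2 (D / (s1 + s2 + a2 * P2)),
         r.2 <= 2^-1 * log2 (1 + a2 * P2 / s1)
                - 2^-1 * log2 (D / (s1 + s2 + a1 * P1)) &
         r.1 + r.2 <= 2^-1 * log2 (1 + (P1 + P2) / s1)
                - 2^-1 * log2 (1 + (P1 + P2) / (s1 + s2))]]].

End GMACWT.

(* Main.v *)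
(** The regions in the union are all contained in the one for a1 = a2 = 1,
    b = 0, so it suffices to prove, besides the sum-rate bound,
    R_2 <= 1/2 log (1 + P2 / s1) and the sharper bound where the wiretapper's
    term 1/2 log ((s1 + s2 + P2) / (s1 + s2 + P1)) is subtracted; user 1 follows
    by exchanging the users.  No entropy power inequality is needed: every
    information inequality involved is a case of ln t <= t - 1, integrated
    against the joint density p of (Y, Z) given the messages and the encoders'
    randomness, at t = f q / p.  Here q is a Gaussian reference density, whose
    log-likelihood is a quadratic form evaluated by the second moments, and f
    multiplies the decoder's weight (1 on the correct message, 1/m on a wrong
    one, which gives Fano's inequality) with the reciprocal of the posterior
    probability at the wiretapper.  All integrands can be kept nonnegative, so
    Tonelli suffices and no integrability has to be proved separately. *)
Require Import Defs.
From HB Require Import structures.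
From mathcomp Require Import all_boot all_order all_algebra.
From mathcomp Require Import all_classical all_reals all_analysis.
From mathcomp Require Import measurable_realfun ring lra.
Set Implicit Arguments.
Unset Strict Implicit.
Unset Printing Implicit Defensive.
Import Order.TTheory GRing.Theory Num.Theory.
Import numFieldNormedType.Exports.
Local Open Scope classical_set_scope.
Local Open Scope ring_scope.

(** The reference density is always a Gaussian density of Z times a Gaussian density of Y given Z,
    the latter centred at the linear least-squares estimate of Y. A bound then comes out as N/2
    times the logarithm of the product of these two variances over s1 * s2, and the choice of the
    centres decides which mutual information it bounds. The obstacle to the sharper bound is that Z
    contains the signal of user 1, whose law is arbitrary. The wiretapper's posterior is therefore
    replaced by a mismatched one: W1 uniform, and W2 inferred as if the signal of user 1 were
    Gaussian noise of power P1. By Gibbs' inequality a mismatched posterior only overestimates the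
    equivocation. W1 is charged its full entropy, and this cancels against R1. The [- 1] of ln t <=
    t - 1 is given away and the decoder's weights are not normalised. Each such loss is a constant
    per message pair, so it vanishes on division by N. *)

(** * Lebesgue measure on R^n and iterated integrals *)

Section Euclidean.
Context {R : realType}.
Implicit Types n : nat.

(** The sigma-algebra is that of [Rn_measurable], so the measurability assumed of the decoder is
    measurability in this type. *)
Definition Rn n := g_sigma_algebraType (@cylinders R n).

Lemma measurable_coord n (i : 'I_n) :
  measurable_fun [set: Rn n] (fun v : Rn n => v i).
Proof.
move=> _ B mB; rewrite setTI; apply: sub_sigma_algebra.
by exists i, B.
Qed.

Lemma measurable_fun_coords d (T : measurableType d) n (f : T -> Rn n) :
  (forall i, measurable_fun setT (fun t => f t i)) -> measurable_fun setT f.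
Proof.
move=> mf; apply: (@measurability _ _ T (Rn n) setT f (@cylinders R n)) => //.
move=> _ [_ [i [B [mB ->]]] <-].
exact: mf.
Qed.

Definition vconsp n (p : measurableTypeR R * Rn n) : Rn n.+1 := vcons p.1 p.2.
Definition vunconsp n (v : Rn n.+1) : measurableTypeR R * Rn n :=
  (v ord0, fun i => v (lift ord0 i)).

Lemma vcons0 n x (v : 'I_n -> R) : vcons x v ord0 = x.
Proof. by rewrite /vcons unlift_none. Qed.

Lemma vcons_lift n x (v : 'I_n -> R) i : vcons x v (lift ord0 i) = v i.
Proof. by rewrite /vcons liftK. Qed.

Lemma measurable_vconsp n : measurable_fun setT (@vconsp n).
Proof.
apply: measurable_fun_coords => i; case: (unliftP ord0 i) => [j|] ->.
  rewrite (_ : (fun p => _) = (fun v : Rn n => v j) \o snd).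
    by apply: measurableT_comp; [exact: measurable_coord|exact: measurable_snd].
  by apply/funext => p; exact: vcons_lift.
rewrite (_ : (fun p => _) = fst); first exact: measurable_fst.
by apply/funext => p; exact: vcons0.
Qed.

Lemma measurable_vunconsp n : measurable_fun setT (@vunconsp n).
Proof.
apply: measurable_fun_pair; first exact: measurable_coord.
by apply: measurable_fun_coords => i; exact: measurable_coord.
Qed.

Lemma vunconspK n : cancel (@vconsp n) (@vunconsp n).
Proof.
move=> [x v]; rewrite /vunconsp /vconsp vcons0; congr pair.
by apply/funext => i; rewrite vcons_lift.
Qed.

Section cons_measure.
Variables (n : nat) (m : {sigma_finite_measure set (Rn n) -> \bar R}).

Let mvconsp := @measurable_vconsp n.
Let mu := pushforward (@lebesgue_measure R \x m)%E (@vconsp n).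

Let mu0 : mu set0 = 0%E. Proof. exact: measure0. Qed.

Let mu_ge0 A : (0 <= mu A)%E. Proof. exact: measure_ge0. Qed.

Let mu_sigma_additive : semi_sigma_additive mu.
Proof. exact: measure_semi_sigma_additive. Qed.

HB.instance Definition _ := isMeasure.Build _ _ _ mu
  mu0 mu_ge0 mu_sigma_additive.

Let mu_sigma_finite : sigma_finite setT mu.
Proof.
have /sigma_finiteP[F [FT Fnd Foo]] := sigma_finiteT (@lebesgue_measure R).
have /sigma_finiteP[G [GT Gnd Goo]] := sigma_finiteT m.
exists (fun k => (@vunconsp n) @^-1` (F k `*` G k)).
  rewrite -preimage_bigcup; apply/esym/seteqP; split => // v _ /=.
  have [i _ Fi] : (\bigcup_i F i) (v ord0) by rewrite -FT.
  have [j _ Gj] : (\bigcup_i G i) (vunconsp v).2 by rewrite -GT.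
  (* Both exhausting sequences increase, so the larger index serves for both coordinates. *)
  exists (maxn i j) => //; split => /=.
    by move: Fi; apply/subsetPset/Fnd/leq_maxl.
  by move: Gj; apply/subsetPset/Gnd/leq_maxr.
move=> k; have [mF Fk] := Foo k; have [mG Gk] := Goo k; split.
  rewrite -[X in measurable X]setTI; apply: measurable_vunconsp => //.
  exact: measurableX.
rewrite /mu /pushforward -comp_preimage.
rewrite (_ : _ \o _ = id); last exact/funext/vunconspK.
by rewrite preimage_id product_measure1E// lte_mul_pinfty// ge0_fin_numE.
Qed.

HB.instance Definition _ := Measure_isSigmaFinite.Build _ _ _ mu mu_sigma_finite.

Definition cons_measure : {sigma_finite_measure set (Rn n.+1) -> \bar R} := mu.

End cons_measure.

(** The recursion is that of [lebN], so the two can be compared one coordinate at a time; the Dirac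
    mass in dimension 0 matches the evaluation there. *)
Fixpoint lebesgue_n n : {sigma_finite_measure set (Rn n) -> \bar R} :=
  match n with
  | 0 => \d_((fun _ => 0) : Rn 0)
  | n'.+1 => cons_measure (lebesgue_n n')
  end.

Local Open Scope ereal_scope.

Lemma integral_lebesgue0 (F : Rn 0 -> \bar R) : (forall v, 0 <= F v) ->
  measurable_fun setT F ->
  \int[lebesgue_n 0]_v F v = F (fun _ => 0%R).
Proof. by move=> F0 mF; rewrite integral_dirac// diracT mul1e. Qed.

Lemma integral_lebesgueS n (F : Rn n.+1 -> \bar R) : (forall v, 0 <= F v) ->
  measurable_fun setT F ->
  \int[lebesgue_n n.+1]_v F v =
  \int[@lebesgue_measure R]_x \int[lebesgue_n n]_v F (vcons x v).
Proof.
move=> F0 mF; rewrite (ge0_integral_pushforward (@measurable_vconsp n))//.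
rewrite preimage_setT (fubini_tonelli1 (F \o @vconsp n))//.
- exact: measurableT_comp mF (@measurable_vconsp n).
- by move=> p; exact: F0.
Qed.

Lemma lebN_ge0 n (F : Rn n -> R) : (forall v, 0 <= F v)%R -> (0 <= lebN F)%R.
Proof.
elim: n F => [|n IH] F F0 /=; first exact: F0.
by apply: Rintegral_ge0 => x _; exact: IH.
Qed.

(** The parameter space [T] is what makes the induction work: the coordinate that is peeled off
    joins the parameter. *)
Lemma measurable_lebN d (T : measurableType d) n (F : T -> Rn n -> R) :
  (forall t v, 0 <= F t v)%R ->
  measurable_fun setT (fun p : T * Rn n => F p.1 p.2) ->
  measurable_fun setT (fun t => lebN (F t)).
Proof.
elim: n d T F => [|n IH] d T F F0 mF /=.
  exact: measurableT_comp mF (pair2_measurable _).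
pose G (p : T * measurableTypeR R) (v : Rn n) := F p.1 (vconsp (p.2, v)).
have mG : measurable_fun setT (fun p => lebN (G p)).
  apply: IH => [p v|]; first exact: F0.
  apply: (measurableT_comp (g := fun p : (T * measurableTypeR R) * Rn n =>
    (p.1.1, vconsp (p.1.2, p.2))) mF).
  apply: measurable_fun_pair => /=.
    by apply: measurableT_comp => //; exact: measurable_fst.
  apply: (measurableT_comp (@measurable_vconsp n)).
  apply: measurable_fun_pair => /=; last exact: measurable_snd.
  by apply: measurableT_comp => //; exact: measurable_fst.
rewrite /Rintegral; apply: measurableT_comp => //.
apply: (measurable_fun_fubini_tonelli_F (m2 := @lebesgue_measure R)
  (fun p => (lebN (G p))%:E)).
  exact/measurable_EFinP.
by move=> p; rewrite lee_fin; apply: lebN_ge0 => v; exact: F0.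
Qed.

(** [lebN] applies [fine] at every level and so sends an infinite inner integral to 0. Finiteness of
    the total integral confines this to a null set of the first coordinate, and elsewhere the
    induction hypothesis applies. *)
Lemma lebN_lebesgue n (F : Rn n -> R) : (forall v, (0 <= F v)%R) ->
  measurable_fun setT F -> \int[lebesgue_n n]_v (F v)%:E < +oo ->
  (lebN F)%:E = \int[lebesgue_n n]_v (F v)%:E.
Proof.
elim: n F => [|n IH] F F0 mF Foo.
  rewrite integral_lebesgue0//; exact/measurable_EFinP.
have mF2 : measurable_fun setT
    (fun p : measurableTypeR R * Rn n => (F (vconsp p))%:E).
  by apply/measurable_EFinP; apply: measurableT_comp => //; exact: measurable_vconsp.
have F20 (p : measurableTypeR R * Rn n) : 0 <= (F (vconsp p))%:E by rewrite lee_fin.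
rewrite integral_lebesgueS; [|by move=> v; rewrite lee_fin|
  exact/measurable_EFinP].
have mG : measurable_fun setT (fun x => \int[lebesgue_n n]_v (F (vcons x v))%:E).
  exact: (measurable_fun_fubini_tonelli_F (m2 := lebesgue_n n) _ mF2 F20).
rewrite integral_lebesgueS in Foo; [|by move=> v; rewrite lee_fin|
  exact/measurable_EFinP].
have G0 x : 0 <= \int[lebesgue_n n]_v (F (vcons x v))%:E.
  by apply: integral_ge0 => v _; rewrite lee_fin.
have Gfin : {ae @lebesgue_measure R, forall x,
    \int[lebesgue_n n]_v (F (vcons x v))%:E < +oo}.
  have iG : (@lebesgue_measure R).-integrable setT
      (fun x => \int[lebesgue_n n]_v (F (vcons x v))%:E).
    apply/integrableP; split => //.
    by under eq_integral do rewrite gee0_abs//.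
  have := integrable_ae measurableT iG.
  apply: (@filterS _ _ (ae_filter_ringOfSetsType (@lebesgue_measure R))) => x /(_ I).
  by rewrite ge0_fin_numE.
rewrite /= /Rintegral -[RHS]fineK; last first.
  by rewrite ge0_fin_numE//; exact: integral_ge0.
congr (fine _)%:E; apply: ae_eq_integral => //.
  apply/measurable_EFinP; apply: (@measurable_lebN _ (measurableTypeR R)) => //.
  apply: measurableT_comp mF _; exact: measurable_vconsp.
move: Gfin; apply: (@filterS _ _ (ae_filter_ringOfSetsType (@lebesgue_measure R))) => x xoo _; apply: IH => //.
apply: (measurableT_comp mF).
exact: measurableT_comp (@measurable_vconsp n) (pair1_measurable _).
Qed.

Lemma integral_prod_lebesgue n (f : 'I_n -> R -> R) :
  (forall i x, (0 <= f i x)%R) -> (forall i, measurable_fun setT (f i)) ->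
  \int[lebesgue_n n]_v (\prod_(i < n) f i (v i))%:E =
  \prod_(i < n) \int[@lebesgue_measure R]_x (f i x)%:E.
Proof.
elim: n f => [|n IH] f f0 mf.
  under eq_integral do rewrite big_ord0.
  by rewrite integral_lebesgue0// big_ord0.
have mprod m (g : 'I_m -> R -> R) : (forall i, measurable_fun setT (g i)) ->
    measurable_fun setT (fun v : Rn m => (\prod_(i < m) g i (v i))%:E).
  move=> mg; apply/measurable_EFinP; apply: measurable_prod => i _.
  exact: measurableT_comp (mg i) (measurable_coord _).
rewrite integral_lebesgueS; [|by move=> v; rewrite lee_fin prodr_ge0|
  exact: mprod].
rewrite big_ord_recl -IH//.
rewrite -ge0_integralZr.
- apply: eq_integral => x _; rewrite -ge0_integralZl_EFin.
  + apply: eq_integral => v _; rewrite big_ord_recl vcons0 EFinM.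
    by congr (_ * _%:E); apply: eq_bigr => i _; rewrite vcons_lift.
  + exact: measurableT.
  + by move=> v _; rewrite lee_fin prodr_ge0.
  + exact: (mprod n (fun i => f (lift ord0 i))).
  + exact: f0.

- exact: measurableT.
- by apply/measurable_EFinP; exact: mf.
- by move=> x _; rewrite lee_fin.
- by apply: integral_ge0 => v _; rewrite lee_fin prodr_ge0.
Qed.
End Euclidean.

(** * Gaussian densities on the line and their second moments *)

Section Gaussian.
Context {R : realType}.
Implicit Types v x m c : R.
Local Notation mu := (@lebesgue_measure R).

(** The image of Lebesgue measure under a reflection gives every interval its length, and this
    determines the measure. *)
Lemma ge0_integral_reflect c (f : R -> \bar R) :
  measurable_fun setT f -> (forall x, 0 <= f x)%E ->
  (\int[mu]_x f (c - x)%R = \int[mu]_x f x)%E.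
Proof.
move=> mf f0.
have mr : measurable_fun [set: measurableTypeR R]
    ((fun x => c - x) : _ -> measurableTypeR R) by exact: measurable_funB.
pose nu : {measure set (measurableTypeR R) -> \bar R} :=
  measure_function_pushforward__canonical__measure_function_Measure mu mr.
have nuE A : measurable A -> nu A = mu A.
  move=> mA; apply/esym; apply: (lebesgue_measure_unique (mu := nu)) => // _ [[a b]] _ <-.
  rewrite /nu/= /pushforward (_ : _ @^-1` _ = `[c - b, c - a[%classic); last first.
    by apply/seteqP; split => x /=; rewrite !in_itv/= => /andP[? ?];
      apply/andP; split; lra.
  rewrite !lebesgue_measure_itv/= !lte_fin.
  rewrite (_ : (c - b < c - a) = (a < b)); last by rewrite ltrD2l ltrN2.
  by case: ifP => // _; rewrite -!EFinD; congr EFin; ring.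
have <- : (\int[nu]_x f x = \int[mu]_x f (c - x)%R)%E.
  by rewrite (ge0_integral_pushforward mr mu measurableT mf).
by apply: eq_measure_integral => A mA _; exact: nuE.
Qed.

Lemma gdens_gt0 v x : 0 < v -> 0 < gdens v x.
Proof.
move=> v0; rewrite /gdens divr_gt0 ?expR_gt0// sqrtr_gt0.
by rewrite mulrn_wgt0// mulr_gt0// pi_gt0.
Qed.

Lemma gdens_ge0 v x : 0 <= gdens v x.
Proof. by rewrite /gdens divr_ge0 ?expR_ge0// sqrtr_ge0. Qed.

Lemma gdens_opp v x : gdens v (- x) = gdens v x.
Proof. by rewrite /gdens sqrrN. Qed.

Lemma gdens_le v x : 0 < v -> gdens v x <= (Num.sqrt (pi * v *+ 2))^-1.
Proof.
move=> v0; rewrite /gdens ler_piMl ?invr_ge0 ?sqrtr_ge0//.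
rewrite -expR0 ler_expR mulNr oppr_le0 divr_ge0 ?sqr_ge0//.
by rewrite mulrn_wge0// ltW.
Qed.

Lemma gdensE v m x : 0 < v -> gdens v (x - m) = normal_pdf m (Num.sqrt v) x.
Proof.
move=> v0; rewrite normal_pdfE ?gt_eqF ?sqrtr_gt0//.
rewrite /normal_peak /normal_fun sqr_sqrtr ?ltW// /gdens mulrC.
by rewrite (mulrC v).
Qed.

Lemma measurable_gdens v : measurable_fun setT (gdens v).
Proof.
rewrite /gdens; apply: measurable_funM => //.
apply: measurableT_comp => //; apply: measurable_funM => //.
by apply: measurableT_comp => //; exact: measurable_funX.
Qed.

Lemma integral_gdens v m : 0 < v -> (\int[mu]_x (gdens v (x - m))%:E = 1)%E.
Proof.
move=> v0; under eq_integral do rewrite gdensE//.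
exact: integral_normal_pdf.
Qed.

Let measurable_gdens_shift v m : measurable_fun setT (fun x => gdens v (x - m)).
Proof.
by apply: (measurableT_comp (measurable_gdens v)); exact: measurable_funB.
Qed.

Local Ltac meas_gauss :=
  try apply/measurable_EFinP;
  repeat first [done | exact: measurable_gdens_shift
    | apply: measurable_funM | apply: measurable_funD
    | apply: measurable_funX | apply: measurable_funB].

(* [1 + t <= expR t] compares the variance-[v] density with the density of
   variance [v * r ^+ 2]; letting [r] tend to 1 from both sides gives the
   second moment without integrating by parts. *)
Let gdens_compare v m r x : 0 < v -> 0 < r ->
  gdens v (x - m) * (1 + (x - m) ^+ 2 * ((1 - r ^- 2) / (v *+ 2)))
  <= r * gdens (v * r ^+ 2) (x - m).
Proof.
move=> v0 r0; set y := x - m.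
have -> : r * gdens (v * r ^+ 2) y =
    gdens v y * expR (y ^+ 2 * ((1 - r ^- 2) / (v *+ 2))).
  rewrite /gdens mulrAC -expRD.
  rewrite (_ : - y ^+ 2 / (v *+ 2) + _ = - y ^+ 2 / (v * r ^+ 2 *+ 2)); last first.
    by field; rewrite !gt_eqF.
  rewrite mulrCA; congr (_ * _).
  rewrite mulrA -mulrnAl sqrtrM; last by rewrite mulrn_wge0// mulr_ge0 ?pi_ge0 ?ltW.
  rewrite sqrtr_sqr gtr0_norm// invfM mulrCA divff ?mulr1 ?gt_eqF//.
by rewrite ler_wpM2l ?gdens_ge0// expR_ge1Dx.
Qed.

Lemma integral_gdens_sqr v m : 0 < v ->
  (\int[mu]_x (gdens v (x - m) * (x - m) ^+ 2)%:E = v%:E)%E.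
Proof.
move=> v0; set I := (\int[mu]_x _)%E.
have mX : measurable_fun setT (fun x => gdens v (x - m) * (x - m) ^+ 2).
  by apply: measurable_funM => //; apply: measurable_funX; exact: measurable_funB.
have X0 x : 0 <= gdens v (x - m) * (x - m) ^+ 2.
  by rewrite mulr_ge0 ?gdens_ge0 ?sqr_ge0.
have I0 : (0 <= I)%E by apply: integral_ge0 => x _; rewrite lee_fin.
have rI r : 0 < r -> (\int[mu]_x (r * gdens (v * r ^+ 2) (x - m))%:E = r%:E)%E.
  move=> r0; under eq_integral do rewrite EFinM.
  rewrite ge0_integralZl_EFin//; last 3 first.
  - by move=> x _; rewrite lee_fin gdens_ge0.
  - meas_gauss.
  - exact: ltW.
  by rewrite integral_gdens ?mule1// mulr_gt0// exprn_gt0.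
(* For r > 1 the coefficient of the square in [gdens_compare] is nonnegative, so both sides
   integrate as they stand; for r < 1, in [dn], the square term is moved to the other side. *)
have up r : 1 < r -> (1 + ((1 - r ^- 2) / (v *+ 2))%:E * I <= r%:E)%E.
  move=> r1; have r0 : 0 < r by rewrite (lt_trans _ r1).
  have c0 : 0 <= (1 - r ^- 2) / (v *+ 2).
    rewrite divr_ge0 ?mulrn_wge0 ?ltW// subr_gt0 invf_lt1 ?exprn_gt0//.
    by rewrite exprn_egt1.
  rewrite -(rI r r0) -(integral_gdens m v0) -ge0_integralZl_EFin//; last 2 first.
  - by move=> x _; rewrite lee_fin.
  - meas_gauss.
  rewrite -ge0_integralD//; last 4 first.
  - by move=> x _; rewrite lee_fin gdens_ge0.
  - meas_gauss.
  - by move=> x _; rewrite -EFinM lee_fin mulr_ge0.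
  - meas_gauss.
  apply: ge0_le_integral => //.
  - by move=> x _; rewrite -EFinM -EFinD lee_fin addr_ge0 ?gdens_ge0// mulr_ge0.
  - meas_gauss.
  - meas_gauss.
  move=> x _; rewrite -EFinM -EFinD lee_fin.
  apply: le_trans _ (gdens_compare m x v0 r0).
  by rewrite le_eqVlt; apply/orP; left; apply/eqP; ring.
have dn r : 0 < r -> r < 1 -> (1 <= r%:E + ((r ^- 2 - 1) / (v *+ 2))%:E * I)%E.
  move=> r0 r1.
  have c0 : 0 <= (r ^- 2 - 1) / (v *+ 2).
    rewrite divr_ge0 ?mulrn_wge0 ?ltW// subr_gt0 invf_gt1 ?exprn_gt0//.
    by rewrite exprn_ilt1// ltW.
  rewrite -(rI r r0) -(integral_gdens m v0) -ge0_integralZl_EFin//; last 2 first.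
  - by move=> x _; rewrite lee_fin.
  - meas_gauss.
  rewrite -ge0_integralD//; last 4 first.
  - by move=> x _; rewrite lee_fin mulr_ge0 ?gdens_ge0// ltW.
  - meas_gauss.
  - by move=> x _; rewrite -EFinM lee_fin mulr_ge0.
  - meas_gauss.
  apply: ge0_le_integral => //.
  - by move=> x _; rewrite lee_fin gdens_ge0.
  - meas_gauss.
  - meas_gauss.
  move=> x _; rewrite -EFinM -EFinD lee_fin -lerBlDr.
  apply: le_trans _ (gdens_compare m x v0 r0).
  by rewrite le_eqVlt; apply/orP; left; apply/eqP; ring.
(* An infinite moment would turn [up] at r = 2 into +oo <= 2. *)
have Ifin : I \is a fin_num.
  rewrite ge0_fin_numE// ltNge leye_eq; apply/negP => /eqP Iy.
  have := up 2; rewrite ltr1n Iy => /(_ isT).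
  rewrite gt0_muley; first by rewrite addey.
  rewrite lte_fin divr_gt0 ?mulrn_wgt0// subr_gt0 invf_lt1 ?exprn_gt0//.
  by rewrite exprn_egt1// ltr1n.
move: up dn; rewrite -(fineK Ifin); set i := fine I => up dn.
have {}up r : 1 < r -> i * (r + 1) <= v * r ^+ 2 *+ 2.
  move=> r1; have := up r r1; rewrite -EFinM -EFinD lee_fin => h.
  have r0 : 0 < r by rewrite (lt_trans _ r1).
  have e : i * (r + 1) - v * r ^+ 2 *+ 2 =
      (1 + (1 - r ^- 2) / (v *+ 2) * i - r) * (v * r ^+ 2 *+ 2 / (r - 1)).
    by field; rewrite !gt_eqF// subr_gt0.
  rewrite -subr_le0 e mulr_le0_ge0 ?subr_le0// divr_ge0 ?subr_ge0 ?ltW//.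
  by rewrite mulrn_wgt0// mulr_gt0// exprn_gt0.
have {}dn r : 0 < r -> r < 1 -> v * r ^+ 2 *+ 2 <= i * (r + 1).
  move=> r0 r1; have := dn r r0 r1; rewrite -EFinM -EFinD lee_fin => h.
  have e : i * (r + 1) - v * r ^+ 2 *+ 2 =
      (r + (r ^- 2 - 1) / (v *+ 2) * i - 1) * (v * r ^+ 2 *+ 2 / (1 - r)).
    by field; rewrite !gt_eqF// subr_gt0.
  rewrite -subr_ge0 e mulr_ge0 ?subr_ge0// divr_ge0 ?subr_ge0 ?ltW//.
  by rewrite mulrn_wgt0// mulr_gt0// exprn_gt0.
congr EFin; apply/eqP; rewrite eq_le; apply/andP; split; rewrite leNgt; apply/negP => iv.
  (* One explicit r = 1 + e replaces the limit: up to higher order terms [up] says 2 (i - v) <= 3 v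
     e, and this [e] is small enough to contradict it. The case i < v uses r = 1 - e in [dn]
     likewise. *)
  pose e := (i - v) / (v *+ 6 + (i - v)).
  have d0 : 0 < v *+ 6 + (i - v) by lra.
  have e0 : 0 < e by rewrite divr_gt0//; lra.
  have ed : e * (v *+ 6 + (i - v)) = i - v by rewrite divfK ?gt_eqF.
  have e1 : e <= 1 by rewrite ler_pdivrMr//; lra.
  have := up (1 + e); rewrite ltrDl => /(_ e0); nra.
pose e := (v - i) / (v *+ 4).
have i0 : 0 <= i by exact: fine_ge0.
have e0 : 0 < e by rewrite divr_gt0//; lra.
have ed : e * (v *+ 4) = v - i by rewrite divfK ?gt_eqF//; lra.
have e1 : e < 1 by rewrite ltr_pdivrMr//; lra.
have := dn (1 - e); rewrite subr_gt0 => /(_ e1); rewrite gtrBl => /(_ e0); nra.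
Qed.

(** Averaging with the reflection about the mean [m] removes the odd part: the squares of a (x - m)
    + d and a (x - m) - d add up to twice a^2 (x - m)^2 + d^2. No signed integral arises. *)
Lemma integral_gdens_affine_sqr v m a b : 0 < v ->
  (\int[mu]_x (gdens v (x - m) * (a * x + b) ^+ 2)%:E =
   (a ^+ 2 * v + (a * m + b) ^+ 2)%:E)%E.
Proof.
move=> v0; set d := a * m + b; set J := (\int[mu]_x _)%E.
have mA a' b' : measurable_fun setT (fun x => gdens v (x - m) * (a' * x + b') ^+ 2).
  apply: measurable_funM => //; apply: measurable_funX.
  by apply: measurable_funD => //; exact: measurable_funM.
have A0 a' b' x : 0 <= gdens v (x - m) * (a' * x + b') ^+ 2.
  by rewrite mulr_ge0 ?gdens_ge0 ?sqr_ge0.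
have JE : J = (\int[mu]_x (gdens v (x - m) * (a * x + (b - d *+ 2)) ^+ 2)%:E)%E.
  rewrite /J -(ge0_integral_reflect (m *+ 2))//; last 2 first.
  - meas_gauss.
  - by move=> x; rewrite lee_fin.
  apply: eq_integral => x _.
  rewrite -(gdens_opp v (x - m)) (_ : m *+ 2 - x - m = - (x - m)); last by ring.
  by congr (_ * _)%:E; rewrite /d; ring.
have J2 : (J + J = (2 * (a ^+ 2 * v + d ^+ 2))%:E)%E.
  rewrite {1}JE /J -ge0_integralD//; last 4 first.
  - by move=> x _; rewrite lee_fin.
  - meas_gauss.
  - by move=> x _; rewrite lee_fin.
  - meas_gauss.
  transitivity (\int[mu]_x ((2 * a ^+ 2)%:E * (gdens v (x - m) * (x - m) ^+ 2)%:E +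
      (2 * d ^+ 2)%:E * (gdens v (x - m))%:E))%E.
    apply: eq_integral => x _; rewrite -!EFinM -!EFinD; congr EFin.
    by rewrite /d; ring.
  have mX : measurable_fun setT (fun x => gdens v (x - m) * (x - m) ^+ 2).
    by apply: measurable_funM => //; apply: measurable_funX; exact: measurable_funB.
  have X0 x : 0 <= gdens v (x - m) * (x - m) ^+ 2.
    by rewrite mulr_ge0 ?gdens_ge0 ?sqr_ge0.
  have a0 : 0 <= 2 * a ^+ 2 by rewrite mulr_ge0 ?sqr_ge0.
  have d0 : 0 <= 2 * d ^+ 2 by rewrite mulr_ge0 ?sqr_ge0.
  rewrite ge0_integralD; [|done| | | |]; last 4 first.
  - by move=> x _; rewrite -EFinM lee_fin mulr_ge0.
  - meas_gauss.
  - by move=> x _; rewrite -EFinM lee_fin mulr_ge0 ?gdens_ge0.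
  - meas_gauss.
  rewrite ge0_integralZl_EFin; [|done| | |done]; last 2 first.
  - by move=> x _; rewrite lee_fin.
  - meas_gauss.
  rewrite ge0_integralZl_EFin; [|done| | |done]; last 2 first.
  - by move=> x _; rewrite lee_fin gdens_ge0.
  - meas_gauss.
  rewrite integral_gdens_sqr// integral_gdens//.
  by rewrite mule1 -EFinM -EFinD; congr EFin; ring.
have J0 : (0 <= J)%E by apply: integral_ge0 => x _; rewrite lee_fin.
case: J J0 J2 {JE} => [j|//|//] _; rewrite -EFinD => -[] h; congr EFin.
lra.
Qed.

(* The product of two densities as the density of the sum times the
   posterior density, by completing the square. *)
Lemma gdens_convol_split v1 v2 x y z : 0 < v1 -> 0 < v2 ->
  gdens v1 (y - x) * gdens v2 (z - y) =
  gdens (v1 + v2) (z - x) *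
    gdens (v1 * v2 / (v1 + v2)) (y - (x + v1 / (v1 + v2) * (z - x))).
Proof.
move=> v10 v20; have v0 : 0 < v1 + v2 by rewrite addr_gt0.
have t0 : 0 < v1 * v2 / (v1 + v2) by rewrite divr_gt0// mulr_gt0.
rewrite /gdens !mulrA -![_ / _ * expR _]mulrAC -!expRD -!mulrA -!invfM.
rewrite -!sqrtrM; try by rewrite mulrn_wge0// mulr_ge0 ?pi_ge0 ?ltW.
congr (expR _ / Num.sqrt _); first by field; rewrite !gt_eqF.
by field; rewrite !gt_eqF.
Qed.

Lemma ln_gdens v x : 0 < v ->
  ln (gdens v x) = - (x ^+ 2 / (v *+ 2)) - 2^-1 * ln (pi * v *+ 2).
Proof.
move=> v0; have p0 : 0 < pi * v *+ 2 :> R by rewrite mulrn_wgt0// mulr_gt0 ?pi_gt0.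
have s0 : 0 < Num.sqrt (pi * v *+ 2) by rewrite sqrtr_gt0.
have -> : ln (pi * v *+ 2) = ln (Num.sqrt (pi * v *+ 2)) *+ 2.
  by rewrite -lnXn// sqr_sqrtr// ltW.
rewrite /gdens ln_div ?posrE ?expR_gt0// expRK; lra.
Qed.

End Gaussian.

(** * Products of sigma-finite measures, packed so that they can be factors again *)

Section SigmaFiniteProduct.
Context d1 d2 (T1 : measurableType d1) (T2 : measurableType d2) (R : realType).
Variables (m1 : {sigma_finite_measure set T1 -> \bar R})
  (m2 : {sigma_finite_measure set T2 -> \bar R}).

Let prod_sigma_finite : sigma_finite setT (m1 \x m2)%E.
Proof.
have /sigma_finiteP[F [FT Fnd Foo]] := sigma_finiteT m1.
have /sigma_finiteP[G [GT Gnd Goo]] := sigma_finiteT m2.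
exists (fun k => F k `*` G k).
  apply/esym/seteqP; split => // -[x y] _ /=.
  have [i _ Fi] : (\bigcup_i F i) x by rewrite -FT.
  have [j _ Gj] : (\bigcup_i G i) y by rewrite -GT.
  exists (maxn i j) => //; split => /=.
    by move: Fi; apply/subsetPset/Fnd/leq_maxl.
  by move: Gj; apply/subsetPset/Gnd/leq_maxr.
move=> k; have [mF Fk] := Foo k; have [mG Gk] := Goo k.
split; first exact: measurableX.
by rewrite product_measure1E// lte_mul_pinfty// ge0_fin_numE.
Qed.

Let mix := @Measure_isSigmaFinite.Build _ _ _ (m1 \x m2)%E prod_sigma_finite.

Definition prodm : {sigma_finite_measure set (T1 * T2)%type -> \bar R} :=
  HB.pack (m1 \x m2)%E mix.

Local Open Scope ereal_scope.

Lemma integral_prodm (f : T1 * T2 -> \bar R) : (forall p, 0 <= f p) ->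
  measurable_fun setT f ->
  \int[prodm]_p f p = \int[m1]_x \int[m2]_y f (x, y).
Proof. by move=> f0 mf; exact: fubini_tonelli1. Qed.

Lemma integral_prodm_swap (f : T1 * T2 -> \bar R) : (forall p, 0 <= f p) ->
  measurable_fun setT f ->
  \int[prodm]_p f p = \int[m2]_y \int[m1]_x f (x, y).
Proof. by move=> f0 mf; exact: fubini_tonelli2. Qed.

Lemma measurable_integral_fst (f : T1 * T2 -> \bar R) : (forall p, 0 <= f p) ->
  measurable_fun setT f -> measurable_fun setT (fun x => \int[m2]_y f (x, y)).
Proof. by move=> f0 mf; exact: measurable_fun_fubini_tonelli_F. Qed.

Lemma measurable_integral_snd (f : T1 * T2 -> \bar R) : (forall p, 0 <= f p) ->
  measurable_fun setT f -> measurable_fun setT (fun y => \int[m1]_x f (x, y)).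
Proof. by move=> f0 mf; exact: measurable_fun_fubini_tonelli_G. Qed.

End SigmaFiniteProduct.

(** * Gaussian vectors with independent coordinates *)

Section GaussianN.
Context {R : realType}.
Implicit Types (v a : R) (N : nat).

Definition gdensN N v (f : 'I_N -> R) : R := \prod_(i < N) gdens v (f i).

Lemma gdensN_gt0 N v (f : 'I_N -> R) : 0 < v -> 0 < gdensN v f.
Proof. by move=> v0; apply: prodr_gt0 => i _; exact: gdens_gt0. Qed.

Lemma gdensN_ge0 N v (f : 'I_N -> R) : 0 <= gdensN v f.
Proof. by apply: prodr_ge0 => i _; exact: gdens_ge0. Qed.

Lemma gdensN_le N v (f : 'I_N -> R) : 0 < v ->
  gdensN v f <= (Num.sqrt (pi * v *+ 2))^-1 ^+ N.
Proof.
move=> v0; rewrite -[N in leRHS]card_ord -prodr_const.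
by apply: ler_prod => i _; rewrite gdens_ge0 gdens_le.
Qed.

Lemma measurable_gdensN d (T : measurableType d) N v (f : T -> 'I_N -> R) :
  (forall i, measurable_fun setT (fun t => f t i)) ->
  measurable_fun setT (fun t => gdensN v (f t)).
Proof.
move=> mf; apply: measurable_prod => i _.
exact: measurableT_comp (measurable_gdens v) (mf i).
Qed.

Let measurable_shift v (m : R) : measurable_fun setT (fun x : R => gdens v (x - m)).
Proof.
by apply: (measurableT_comp (measurable_gdens v)); exact: measurable_funB.
Qed.

Let measurable_shiftN N v (c : 'I_N -> R) :
  measurable_fun setT (fun y : Rn N => gdensN v (fun i => y i - c i)).
Proof.
apply: measurable_gdensN => i.
by apply: measurable_funB => //; exact: measurable_coord.
Qed.

Local Open Scope ereal_scope.

Lemma integral_gdensN N v (c : 'I_N -> R) : (0 < v)%R ->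
  \int[lebesgue_n N]_y (gdensN v (fun i => y i - c i)%R)%:E = 1.
Proof.
move=> v0.
rewrite (integral_prod_lebesgue (f := fun i x => gdens v (x - c i)))//.
  by rewrite big1// => i _; exact: integral_gdens.
by move=> i x; exact: gdens_ge0.
Qed.

Lemma integral_gdensN_sqr N v (c b : 'I_N -> R) a : (0 < v)%R ->
  \int[lebesgue_n N]_y (gdensN v (fun i => y i - c i) *
     \sum_(i < N) (a * y i + b i) ^+ 2)%R%:E =
  (\sum_(i < N) (a ^+ 2 * v + (a * c i + b i) ^+ 2))%R%:E.
Proof.
move=> v0.
have mA i : measurable_fun setT (fun x => (a * x + b i) ^+ 2)%R.
  by apply: measurable_funX; apply: measurable_funD => //; exact: measurable_funM.
under eq_integral do rewrite mulr_sumr -sumEFin.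
rewrite ge0_integral_sum//; last 2 first.
- move=> i; apply/measurable_EFinP; apply: measurable_funM => //.
  exact: measurableT_comp (mA i) (measurable_coord _).
- by move=> i y _; rewrite lee_fin mulr_ge0 ?sqr_ge0 ?gdensN_ge0.
rewrite -sumEFin; apply: eq_bigr => i _.
(* Attaching the square to the factor of index [i] makes the integrand a product over
   coordinates. *)
pose f j x := (gdens v (x - c j) * (if j == i then (a * x + b i) ^+ 2 else 1))%R.
have f0 j x : (0 <= f j x)%R.
  by rewrite /f mulr_ge0 ?gdens_ge0//; case: ifP => _; rewrite ?sqr_ge0 ?ler01.
have mf j : measurable_fun setT (f j).
  by rewrite /f; case: (j == i); exact: measurable_funM.
transitivity (\int[lebesgue_n N]_y (\prod_(j < N) f j (y j))%R%:E).
  apply: eq_integral => y _; congr EFin.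
  rewrite /f big_split/=; congr (_ * _)%R.
  by rewrite (bigD1 i)//= eqxx big1 ?mulr1// => j /negPf ->.
rewrite integral_prod_lebesgue// (bigD1 i)//= [X in _ * X]big1 ?mule1.
  by rewrite /f eqxx; exact: integral_gdens_affine_sqr.
move=> j /negPf ji; rewrite /f ji.
by under eq_integral do rewrite mulr1; exact: integral_gdens.
Qed.

(** After the square is completed in each coordinate, [y] occurs only in its posterior density given
    x and z, which integrates to 1. *)
Lemma integral_gdensN_convol N v1 v2 (x z : 'I_N -> R) : (0 < v1)%R -> (0 < v2)%R ->
  \int[lebesgue_n N]_y
    (gdensN v1 (fun i => y i - x i) * gdensN v2 (fun i => z i - y i))%R%:E =
  (gdensN (v1 + v2) (fun i => z i - x i)%R)%:E.
Proof.
move=> v10 v20; pose c i := (x i + v1 / (v1 + v2) * (z i - x i))%R.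
under eq_integral => y _.
  rewrite (_ : _ * _ = gdensN (v1 + v2) (fun i => z i - x i) *
      gdensN (v1 * v2 / (v1 + v2)) (fun i => y i - c i))%R; last first.
    by rewrite /gdensN -!big_split/=; apply: eq_bigr => i _; exact: gdens_convol_split.
  rewrite EFinM.
over.
rewrite ge0_integralZl_EFin//; last 3 first.
- by move=> y _; rewrite lee_fin gdensN_ge0.
- exact/measurable_EFinP.
- exact: gdensN_ge0.
by rewrite integral_gdensN ?mule1// divr_gt0 ?mulr_gt0 ?addr_gt0.
Qed.

End GaussianN.

Section RealNonneg.
Context d (T : measurableType d) (R : realType).
Variable m : {measure set T -> \bar R}.
Local Open Scope ereal_scope.

Lemma ge0_integralD_EFin (f g : T -> R) :
  (forall x, (0 <= f x)%R) -> (forall x, (0 <= g x)%R) ->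
  measurable_fun setT f -> measurable_fun setT g ->
  \int[m]_x (f x + g x)%:E = \int[m]_x (f x)%:E + \int[m]_x (g x)%:E.
Proof.
move=> f0 g0 mf mg; under eq_integral do rewrite EFinD.
by apply: ge0_integralD => //; [move=> x _; rewrite lee_fin|exact/measurable_EFinP|
  move=> x _; rewrite lee_fin|exact/measurable_EFinP].
Qed.

Lemma ge0_integralZ_EFin (c : R) (f : T -> R) :
  (0 <= c)%R -> (forall x, (0 <= f x)%R) -> measurable_fun setT f ->
  \int[m]_x (c * f x)%:E = c%:E * \int[m]_x (f x)%:E.
Proof.
move=> c0 f0 mf; under eq_integral do rewrite EFinM.
by apply: ge0_integralZl_EFin => //; [move=> x _; rewrite lee_fin|exact/measurable_EFinP].
Qed.

Lemma ge0_integralZr_EFin (c : R) (f : T -> R) :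
  (0 <= c)%R -> (forall x, (0 <= f x)%R) -> measurable_fun setT f ->
  \int[m]_x (f x * c)%:E = \int[m]_x (f x)%:E * c%:E.
Proof.
move=> c0 f0 mf; under eq_integral do rewrite mulrC.
by rewrite ge0_integralZ_EFin// muleC.
Qed.

Lemma ge0_le_integral_EFin (f g : T -> R) :
  (forall x, (0 <= f x)%R) -> (forall x, (f x <= g x)%R) ->
  measurable_fun setT f -> measurable_fun setT g ->
  \int[m]_x (f x)%:E <= \int[m]_x (g x)%:E.
Proof.
move=> f0 fg mf mg; apply: ge0_le_integral => //.
- by move=> x _; rewrite lee_fin.
- exact/measurable_EFinP.
- exact/measurable_EFinP.
- by move=> x _; rewrite lee_fin.
Qed.

End RealNonneg.

(** * The joint density of both outputs and its expectations *)

Section Core.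
Context {R : realType} d (O : measurableType d).
Variables (Q : {sigma_finite_measure set O -> \bar R}).
Hypothesis QT : Q setT = 1%E.
Variables (N : nat) (X : O -> 'I_N -> R).
Hypothesis mX : forall i, measurable_fun setT (fun u => X u i).
Variables s1 s2 : R.
Hypotheses (s10 : 0 < s1) (s20 : 0 < s2).

Local Notation Y := (@Rn R N).
Local Notation lam := (@lebesgue_n R N).

Definition joint (p : O * (Rn N * Rn N)) : R :=
  gdensN s1 (fun i => p.2.1 i - X p.1 i) * gdensN s2 (fun i => p.2.2 i - p.2.1 i).

(** This is the dominating measure with respect to which [joint] is a density, not the joint law
    itself. *)
Definition jointm := prodm Q (prodm (@lebesgue_n R N) (@lebesgue_n R N)).

Lemma measurable_in (f : O -> R) : measurable_fun setT f ->
  measurable_fun setT (fun p : O * (Y * Y) => f p.1).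
Proof. by move=> mf; apply: measurableT_comp => //; exact: measurable_fst. Qed.

Lemma measurable_out1 (f : Y -> R) : measurable_fun setT f ->
  measurable_fun setT (fun p : O * (Y * Y) => f p.2.1).
Proof.
move=> mf; apply: (measurableT_comp mf).
exact: measurableT_comp (@measurable_fst _ _ _ _) (@measurable_snd _ _ _ _).
Qed.

Lemma measurable_out2 (f : Y -> R) : measurable_fun setT f ->
  measurable_fun setT (fun p : O * (Y * Y) => f p.2.2).
Proof.
move=> mf; apply: (measurableT_comp mf).
exact: measurableT_comp (@measurable_snd _ _ _ _) (@measurable_snd _ _ _ _).
Qed.

Lemma measurable_joint : measurable_fun setT joint.
Proof.
apply: measurable_funM; apply: measurable_gdensN => i; apply: measurable_funB.
- exact: (measurable_out1 (measurable_coord i)).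
- exact: (measurable_in (mX i)).
- exact: (measurable_out2 (measurable_coord i)).
- exact: (measurable_out1 (measurable_coord i)).
Qed.

Lemma joint_ge0 p : 0 <= joint p.
Proof. by rewrite mulr_ge0 ?gdensN_ge0. Qed.

Local Open Scope ereal_scope.

Lemma integral_jointm (f : O * (Y * Y) -> R) : (forall p, (0 <= f p)%R) ->
  measurable_fun setT f ->
  \int[jointm]_p (f p)%:E =
  \int[Q]_u \int[lam]_y \int[lam]_z (f (u, (y, z)))%:E.
Proof.
move=> f0 mf; rewrite integral_prodm.
- apply: eq_integral => u _; rewrite integral_prodm//.
  + by move=> p; rewrite lee_fin.
  + apply/measurable_EFinP; exact: measurableT_comp mf (pair1_measurable u).
- by move=> p; rewrite lee_fin.
- exact/measurable_EFinP.
Qed.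

(** Integrating y out first is the order in which the convolution formula produces the channel to
    Z. *)
Lemma integral_jointm_swap (f : O * (Y * Y) -> R) : (forall p, (0 <= f p)%R) ->
  measurable_fun setT f ->
  \int[jointm]_p (f p)%:E =
  \int[Q]_u \int[lam]_z \int[lam]_y (f (u, (y, z)))%:E.
Proof.
move=> f0 mf; rewrite integral_prodm.
- apply: eq_integral => u _; rewrite integral_prodm_swap//.
  + by move=> p; rewrite lee_fin.
  + apply/measurable_EFinP; exact: measurableT_comp mf (pair1_measurable u).
- by move=> p; rewrite lee_fin.
- exact/measurable_EFinP.
Qed.

Let measurable_shiftN v (c : 'I_N -> R) :
  measurable_fun setT (fun y : Y => gdensN v (fun i => y i - c i)%R).
Proof.
apply: measurable_gdensN => i.
by apply: measurable_funB => //; exact: measurable_coord.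
Qed.

Let measurable_shiftNr v (c : 'I_N -> R) :
  measurable_fun setT (fun y : Y => gdensN v (fun i => c i - y i)%R).
Proof.
apply: measurable_gdensN => i.
by apply: measurable_funB => //; exact: measurable_coord.
Qed.

Let measurable_shiftN2 v :
  measurable_fun setT (fun p : O * Y => gdensN v (fun i => p.2 i - X p.1 i)%R).
Proof.
apply: measurable_gdensN => i; apply: measurable_funB.
- exact: measurableT_comp (measurable_coord i) (@measurable_snd _ _ _ _).
- exact: measurableT_comp (mX i) (@measurable_fst _ _ _ _).
Qed.

Let measurable_affine_sqr (a : R) (c : 'I_N -> R) :
  measurable_fun setT (fun y : Y => \sum_(i < N) (a * y i + c i) ^+ 2)%R.
Proof.
apply: measurable_sum => i; apply: measurable_funX; apply: measurable_funD => //.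
by apply: measurable_funM => //; exact: measurable_coord.
Qed.

Let integral_mixture v (p h : Y -> R) : (forall y, (0 <= h y)%R) ->
  measurable_fun setT h ->
  (forall y, (p y)%:E = \int[Q]_u (gdensN v (fun i => y i - X u i)%R)%:E) ->
  \int[Q]_u \int[lam]_y (gdensN v (fun i => y i - X u i) * h y)%R%:E =
  \int[lam]_y (p y * h y)%:E.
Proof.
move=> h0 mh pE.
pose f (q : O * Y) := (gdensN v (fun i => q.2 i - X q.1 i) * h q.2)%R%:E.
have f0 q : 0 <= f q by rewrite lee_fin mulr_ge0 ?gdensN_ge0.
have mf : measurable_fun setT f.
  apply/measurable_EFinP; apply: measurable_funM => //.
  exact: measurableT_comp mh (@measurable_snd _ _ _ _).
transitivity (\int[Q]_u \int[lam]_y f (u, y)); first by [].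
rewrite -integral_prodm// integral_prodm_swap//; apply: eq_integral => y _.
rewrite EFinM pE -ge0_integralZr_EFin//.
- by move=> u; exact: gdensN_ge0.
- by exact: measurableT_comp (measurable_shiftN2 v) (pair2_measurable y).
Qed.

Lemma integral_joint_out2 (p h : Y -> R) : (forall z, (0 <= h z)%R) ->
  measurable_fun setT h ->
  (forall z, (p z)%:E = \int[Q]_u (gdensN (s1 + s2) (fun i => z i - X u i)%R)%:E) ->
  \int[jointm]_q (joint q * h q.2.2)%:E = \int[lam]_z (p z * h z)%:E.
Proof.
move=> h0 mh pE; rewrite integral_jointm_swap.
- rewrite -(integral_mixture h0 mh pE); apply: eq_integral => u _.
  apply: eq_integral => z _ /=; rewrite ge0_integralZr_EFin//.
  + rewrite EFinM; congr (_ * _).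
    exact: (integral_gdensN_convol (X u) z s10 s20).
  + by move=> y; rewrite mulr_ge0 ?gdensN_ge0.
  + exact: measurable_funM (measurable_shiftN s1 (X u)) (measurable_shiftNr s2 z).
- by move=> q; rewrite mulr_ge0 ?joint_ge0.
- by apply: measurable_funM; [exact: measurable_joint|exact: measurable_out2].
Qed.

Lemma integral_joint_out1 (p h : Y -> R) : (forall y, (0 <= h y)%R) ->
  measurable_fun setT h ->
  (forall y, (p y)%:E = \int[Q]_u (gdensN s1 (fun i => y i - X u i)%R)%:E) ->
  \int[jointm]_q (joint q * h q.2.1)%:E = \int[lam]_y (p y * h y)%:E.
Proof.
move=> h0 mh pE; rewrite integral_jointm.
- rewrite -(integral_mixture h0 mh pE); apply: eq_integral => u _.
  apply: eq_integral => y _ /=.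
  under eq_integral do rewrite /joint /= mulrAC.
  rewrite ge0_integralZ_EFin//.
  + by rewrite integral_gdensN// mule1.
  + by rewrite mulr_ge0 ?gdensN_ge0.
  + by move=> z; exact: gdensN_ge0.
- by move=> q; rewrite mulr_ge0 ?joint_ge0.
- by apply: measurable_funM; [exact: measurable_joint|exact: measurable_out1].
Qed.

Lemma integral_joint : \int[jointm]_q (joint q)%:E = 1.
Proof.
rewrite integral_jointm.
- transitivity (\int[Q]_u (1 : \bar R)).
    apply: eq_integral => u _.
    transitivity (\int[lam]_y (gdensN s1 (fun i => y i - X u i)%R)%:E).
      apply: eq_integral => y _; rewrite /joint/=.
      rewrite ge0_integralZ_EFin ?gdensN_ge0// ?integral_gdensN ?mule1//.
      by move=> z; exact: gdensN_ge0.
    by rewrite integral_gdensN.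
  by rewrite integral_cst// mul1e; exact: QT.
- exact: joint_ge0.
- exact: measurable_joint.
Qed.

(** The affine form is expressed in the two noises y - x and z - y plus a term [xi] of the inputs.
    All log-likelihoods below are multiples of such sums, up to constants. *)
Definition quad (a b : R) (xi : O -> 'I_N -> R) (p : O * (Y * Y)) : R :=
  (\sum_(i < N) (a * (p.2.1 i - X p.1 i) + b * (p.2.2 i - p.2.1 i) + xi p.1 i) ^+ 2)%R.

Lemma quad_ge0 a b xi p : (0 <= quad a b xi p)%R.
Proof. by apply: sumr_ge0 => i _; exact: sqr_ge0. Qed.

Lemma measurable_quad a b xi : (forall i, measurable_fun setT (fun u => xi u i)) ->
  measurable_fun setT (quad a b xi).
Proof.
move=> mxi; apply: measurable_sum => i; apply: measurable_funX.
apply: measurable_funD; last exact: (measurable_in (mxi i)).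
apply: measurable_funD; apply: measurable_funM => //; apply: measurable_funB.
- exact: (measurable_out1 (measurable_coord i)).
- exact: (measurable_in (mX i)).
- exact: (measurable_out2 (measurable_coord i)).
- exact: (measurable_out1 (measurable_coord i)).
Qed.

(** The noises are centred and independent of each other and of the randomness, so no cross term
    survives. *)
Lemma integral_joint_quad a b xi :
  (forall i, measurable_fun setT (fun u => xi u i)) ->
  \int[jointm]_q (joint q * quad a b xi q)%:E =
  \int[Q]_u (N%:R * (a ^+ 2 * s1 + b ^+ 2 * s2) + \sum_(i < N) xi u i ^+ 2)%R%:E.
Proof.
move=> mxi; rewrite integral_jointm.
- apply: eq_integral => u _.
  (* Integrating z out replaces z by its mean y and adds the variance b^2 s2 per coordinate; the
     rest is affine in y. *)
  transitivity (\int[lam]_y (gdensN s1 (fun i => y i - X u i) *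
      \sum_(i < N) (a * y i + (xi u i - a * X u i)) ^+ 2 +
      N%:R * (b ^+ 2 * s2) * gdensN s1 (fun i => y i - X u i))%R%:E).
    apply: eq_integral => y _; rewrite /joint /quad/=.
    under eq_integral => z _.
      rewrite -mulrA (eq_bigr (fun i =>
        (b * z i + (a * (y i - X u i) - b * y i + xi u i)) ^+ 2)%R); last first.
        by move=> i _; congr (_ ^+ 2)%R; ring.
    over.
    rewrite ge0_integralZ_EFin.
    + rewrite integral_gdensN_sqr// -EFinM big_split/= sumr_const card_ord.
      congr EFin; rewrite mulrDr addrC; congr (_ + _)%R; last first.
        by rewrite -[in LHS]mulr_natl mulrC.
      by congr (_ * _)%R; apply: eq_bigr => i _; congr (_ ^+ 2)%R; ring.
    + exact: gdensN_ge0.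
    + by move=> z; apply: mulr_ge0; rewrite ?gdensN_ge0// sumr_ge0// => i _; exact: sqr_ge0.
    + exact: measurable_funM (measurable_shiftN s2 y) (measurable_affine_sqr b _).
  have c0 : (0 <= N%:R * (b ^+ 2 * s2))%R by rewrite mulr_ge0// mulr_ge0 ?sqr_ge0// ltW.
  rewrite ge0_integralD_EFin.
  + rewrite integral_gdensN_sqr// ge0_integralZ_EFin//.
      rewrite integral_gdensN// mule1 -EFinD; congr EFin.
      rewrite big_split/= sumr_const card_ord -mulr_natl.
      rewrite (eq_bigr (fun i => (xi u i) ^+ 2)%R); last first.
        by move=> i _; congr (_ ^+ 2)%R; ring.
      ring.
    by move=> y; exact: gdensN_ge0.
  + by move=> y; rewrite mulr_ge0 ?gdensN_ge0// sumr_ge0// => i _; exact: sqr_ge0.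
  + by move=> y; rewrite mulr_ge0 ?gdensN_ge0.
  + exact: measurable_funM (measurable_shiftN s1 (X u)) (measurable_affine_sqr a _).
  + exact: measurable_funM (measurable_cst _) (measurable_shiftN s1 (X u)).
- by move=> q; rewrite mulr_ge0 ?joint_ge0 ?quad_ge0.
- by apply: measurable_funM; [exact: measurable_joint|exact: measurable_quad].
Qed.

End Core.

Section LogDensity.
Context {R : realType}.
Implicit Types v x : R.

Lemma ln_le_subr1 x : 0 < x -> ln x <= x - 1.
Proof.
by move=> x0; rewrite lerBrDl -[leRHS](lnK x0) expR_ge1Dx.
Qed.

Lemma ln_gdensN N v (f : 'I_N -> R) : 0 < v ->
  ln (gdensN v f) =
  - (\sum_(i < N) f i ^+ 2 / (v *+ 2)) - N%:R * (2^-1 * ln (pi * v *+ 2)).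
Proof.
move=> v0; transitivity (\sum_(i < N)
    (- (f i ^+ 2 / (v *+ 2)) - 2^-1 * ln (pi * v *+ 2))).
  rewrite /gdensN; have [] // : 0 < \prod_(i < N) gdens v (f i) /\
      ln (\prod_(i < N) gdens v (f i)) = \sum_(i < N)
      (- (f i ^+ 2 / (v *+ 2)) - 2^-1 * ln (pi * v *+ 2)).
  apply: (big_rec2 (fun p s => 0 < p /\ ln p = s)); first by rewrite ln1.
  move=> i p s _ [p0 <-]; have g0 := gdens_gt0 (f i) v0.
  by rewrite mulr_gt0// lnM ?posrE// ln_gdens.
by rewrite big_split/= sumrN sumr_const card_ord -mulr_natl; ring.
Qed.

End LogDensity.

(** * The integrated form of ln t <= t - 1 *)

Section CoreBound.
Context {R : realType} d (O : measurableType d).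
Variables (Q : {sigma_finite_measure set O -> \bar R}).
Hypothesis QT : Q setT = 1%E.
Variables (N : nat) (X : O -> 'I_N -> R).
Hypothesis mX : forall i, measurable_fun setT (fun u => X u i).
Variables s1 s2 : R.
Hypotheses (s10 : 0 < s1) (s20 : 0 < s2).

Local Notation Y := (@Rn R N).
Local Notation lam := (@lebesgue_n R N).
Local Notation K := (joint X s1 s2).
Local Notation mK := (jointm Q N).
Local Notation qd := (quad X).
Let zero : O -> 'I_N -> R := fun _ _ => 0.

(* [ln t <= t - 1] at [t = f * q / joint], where [q] is a product of Gaussian
   densities of affine forms of the inputs and outputs. *)
Lemma joint_ln_le (va vb a1 b1 a2 b2 : R) (xi ze : O -> 'I_N -> R) (f : R) p :
  0 < va -> 0 < vb -> 0 < f ->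
  K p * (ln f + qd 1 0 zero p / (s1 *+ 2) + qd 0 1 zero p / (s2 *+ 2)) <=
  K p * (N%:R * (2^-1 * ln (va * vb / (s1 * s2))) +
    qd a1 b1 xi p / (va *+ 2) + qd a2 b2 ze p / (vb *+ 2)) +
  f * (gdensN va (fun i => a1 * (p.2.1 i - X p.1 i) + b1 * (p.2.2 i - p.2.1 i) + xi p.1 i) *
       gdensN vb (fun i => a2 * (p.2.1 i - X p.1 i) + b2 * (p.2.2 i - p.2.1 i) + ze p.1 i)).
Proof.
move=> va0 vb0 f0; set A := gdensN va _; set B := gdensN vb _.
have A0 : 0 < A by exact: gdensN_gt0.
have B0 : 0 < B by exact: gdensN_gt0.
have k0 : 0 < K p by rewrite /joint mulr_gt0 ?gdensN_gt0.
have t0 : 0 < f * (A * B) / K p by rewrite divr_gt0// !mulr_gt0.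
have lnfAB : ln (f * (A * B)) = ln f + (ln A + ln B).
  by rewrite lnM ?posrE ?mulr_gt0// [ln (A * B)]lnM ?posrE.
have lnKp : ln (K p) = ln (gdensN s1 (fun i => p.2.1 i - X p.1 i)) +
    ln (gdensN s2 (fun i => p.2.2 i - p.2.1 i)).
  by rewrite /joint lnM ?posrE ?gdensN_gt0.
have := ln_le_subr1 t0; rewrite ln_div; [|by rewrite posrE !mulr_gt0|by rewrite posrE].
rewrite lnfAB lnKp.
rewrite /A /B !ln_gdensN//.
have p0 : 0 < pi :> R by exact: pi_gt0.
have lnE (v : R) : 0 < v -> ln (pi * v *+ 2) = ln (pi *+ 2) + ln v.
  move=> v0; rewrite -mulrnAl lnM; [by []| |by rewrite posrE].
  by rewrite posrE pmulrn_rgt0.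
have lnv : ln (va * vb / (s1 * s2)) = ln va + ln vb - (ln s1 + ln s2).
  have -> : ln va + ln vb = ln (va * vb) by rewrite lnM ?posrE.
  have -> : ln s1 + ln s2 = ln (s1 * s2) by rewrite lnM ?posrE.
  by rewrite ln_div ?posrE ?mulr_gt0.
rewrite !lnE// lnv.
rewrite -!mulr_suml.
have -> : \sum_(i < N) (p.2.1 i - X p.1 i) ^+ 2 = qd 1 0 zero p.
  by apply: eq_bigr => i _; rewrite mul1r mul0r !addr0.
have -> : \sum_(i < N) (p.2.2 i - p.2.1 i) ^+ 2 = qd 0 1 zero p.
  by apply: eq_bigr => i _; rewrite mul1r mul0r add0r addr0.
rewrite -/A -/B -/(qd a1 b1 xi p) -/(qd a2 b2 ze p) => h.
rewrite -lerBlDl -mulrBr mulrC -ler_pdivlMr//.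
(* Here the [- 1] is given away. *)
by apply: le_trans (_ : _ <= f * (A * B) / K p - 1 + 1) _; lra.
Qed.

Local Open Scope ereal_scope.

(** The quadratic forms of [joint] stand on the left and those of the reference on the right, so
    every term is nonnegative and can be integrated separately. Each form on the left is normalised
    by its own variance and contributes N/2, whence the summand [N]. *)
Lemma core_bound (pY pZ h D : Y -> R) (e : O * (Y * Y) -> R)
    (c L va vb a1 b1 a2 b2 : R) (xi ze : O -> 'I_N -> R) :
  (forall y, (pY y)%:E = \int[Q]_u (gdensN s1 (fun i => y i - X u i)%R)%:E) ->
  (forall z, (pZ z)%:E = \int[Q]_u (gdensN (s1 + s2) (fun i => z i - X u i)%R)%:E) ->
  (forall z, 0 <= h z)%R -> measurable_fun setT h ->
  (forall y, 0 <= D y)%R -> measurable_fun setT D ->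
  (forall p, 0 <= e p)%R -> measurable_fun setT e ->
  (forall i, measurable_fun setT (fun u => xi u i)) ->
  (forall i, measurable_fun setT (fun u => ze u i)) ->
  (0 <= c)%R -> (0 <= L)%R -> (0 < va)%R -> (0 < vb)%R ->
  (forall p, K p * (h p.2.2 + qd 1 0 zero p / (s1 *+ 2)
                        + qd 0 1 zero p / (s2 *+ 2)) <=
     K p * (c + L * D p.2.1 + qd a1 b1 xi p / (va *+ 2)
                + qd a2 b2 ze p / (vb *+ 2)) + e p)%R ->
  \int[lam]_z (pZ z * h z)%:E + N%:R%:E <=
  c%:E + L%:E * \int[lam]_y (pY y * D y)%:E
  + ((va *+ 2)^-1)%:E * \int[Q]_u
      (N%:R * (a1 ^+ 2 * s1 + b1 ^+ 2 * s2) + \sum_(i < N) xi u i ^+ 2)%R%:E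
  + ((vb *+ 2)^-1)%:E * \int[Q]_u
      (N%:R * (a2 ^+ 2 * s1 + b2 ^+ 2 * s2) + \sum_(i < N) ze u i ^+ 2)%R%:E
  + \int[mK]_p (e p)%:E.
Proof.
move=> pYE pZE h0 mh D0 mD e0 me mxi mze c0 L0 va0 vb0 le_ptw.
have k0 p : (0 <= K p)%R by exact: joint_ge0.
have mk : measurable_fun setT K by exact: measurable_joint.
have q0 a b x p : (0 <= K p * qd a b x p)%R by rewrite mulr_ge0 ?quad_ge0.
have mq a b (x : O -> 'I_N -> R) : (forall i, measurable_fun setT (fun u => x u i)) ->
    measurable_fun setT (fun p => K p * qd a b x p)%R.
  by move=> mx; apply: measurable_funM => //; exact: measurable_quad.
have mzero i : measurable_fun setT (fun u : O => zero u i) by exact: measurable_cst.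
have kh0 p : (0 <= K p * h p.2.2)%R by rewrite mulr_ge0.
have mkh : measurable_fun setT (fun p : O * (Y * Y) => K p * h p.2.2)%R.
  by apply: measurable_funM => //; exact: measurable_out2.
have kD0 p : (0 <= K p * D p.2.1)%R by rewrite mulr_ge0.
have mkD : measurable_fun setT (fun p : O * (Y * Y) => K p * D p.2.1)%R.
  by apply: measurable_funM => //; exact: measurable_out1.
have v0 v : (0 < v)%R -> (0 <= (v *+ 2)^-1)%R.
  by move=> ?; rewrite invr_ge0 mulrn_wge0// ltW.
have vq0 v a b x p : (0 < v)%R -> (0 <= (v *+ 2)^-1 * (K p * qd a b x p))%R.
  by move=> ?; rewrite mulr_ge0// v0.
have mvq v a b (x : O -> 'I_N -> R) : (forall i, measurable_fun setT (fun u => x u i)) ->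
    measurable_fun setT (fun p => (v *+ 2)^-1 * (K p * qd a b x p))%R.
  by move=> mx; apply: measurable_funM => //; exact: mq.
have Ivq v a b (x : O -> 'I_N -> R) : (0 < v)%R ->
    (forall i, measurable_fun setT (fun u => x u i)) ->
    \int[mK]_p ((v *+ 2)^-1 * (K p * qd a b x p))%R%:E =
    ((v *+ 2)^-1)%:E * \int[Q]_u
      (N%:R * (a ^+ 2 * s1 + b ^+ 2 * s2) + \sum_(i < N) x u i ^+ 2)%R%:E.
  move=> v0' mx; rewrite ge0_integralZ_EFin//; [|exact: v0|exact: mq].
  by rewrite integral_joint_quad.
have half v a b : (0 < v)%R -> (N%:R * (a ^+ 2 * s1 + b ^+ 2 * s2) = N%:R * v)%R ->
    \int[mK]_p ((v *+ 2)^-1 * (K p * qd a b zero p))%R%:E = (N%:R / 2)%:E.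
  move=> v0' E; rewrite Ivq//.
  transitivity (((v *+ 2)^-1)%:E * \int[Q]_u (N%:R * v)%:E).
    congr (_ * _); apply: eq_integral => u _; rewrite E big1 ?addr0// => i _.
    by rewrite /zero expr0n.
  rewrite integral_cst//= (_ : _ setT = 1); last exact: QT.
  by rewrite mule1 -EFinM; congr EFin; field; rewrite gt_eqF.
have LHSE : \int[lam]_z (pZ z * h z)%:E + N%:R%:E =
    \int[mK]_p (K p * h p.2.2 +
      ((s1 *+ 2)^-1 * (K p * qd 1 0 zero p) +
       (s2 *+ 2)^-1 * (K p * qd 0 1 zero p)))%R%:E.
  rewrite ge0_integralD_EFin//; last 2 first.
  - by move=> p; rewrite addr_ge0// vq0.
  - by apply: measurable_funD; exact: mvq.
  rewrite ge0_integralD_EFin; [|by move=> p; exact: vq0|by move=> p; exact: vq0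
    |exact: mvq|exact: mvq].
  rewrite (integral_joint_out2 mX s10 s20 h0 mh pZE).
  rewrite !half//; [|by rewrite expr0n/= expr1n; ring|by rewrite expr0n/= expr1n; ring].
  by rewrite -EFinD; congr (_ + _%:E); field.
have RHSE : \int[mK]_p ((c * K p + L * (K p * D p.2.1)) +
      ((va *+ 2)^-1 * (K p * qd a1 b1 xi p) +
       (vb *+ 2)^-1 * (K p * qd a2 b2 ze p)) + e p)%R%:E =
   c%:E + L%:E * \int[lam]_y (pY y * D y)%:E
  + ((va *+ 2)^-1)%:E * \int[Q]_u
      (N%:R * (a1 ^+ 2 * s1 + b1 ^+ 2 * s2) + \sum_(i < N) xi u i ^+ 2)%R%:E
  + ((vb *+ 2)^-1)%:E * \int[Q]_u
      (N%:R * (a2 ^+ 2 * s1 + b2 ^+ 2 * s2) + \sum_(i < N) ze u i ^+ 2)%R%:E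
  + \int[mK]_p (e p)%:E.
  have x0 p : (0 <= c * K p)%R by rewrite mulr_ge0.
  have y0 p : (0 <= L * (K p * D p.2.1))%R by rewrite mulr_ge0.
  have mx : measurable_fun setT (fun p => c * K p)%R by exact: measurable_funM.
  have my : measurable_fun setT (fun p : O * (Y * Y) => L * (K p * D p.2.1))%R.
    exact: measurable_funM.
  have z1 p := vq0 va a1 b1 xi p va0; have z2 p := vq0 vb a2 b2 ze p vb0.
  have mz1 := mvq va a1 b1 _ mxi; have mz2 := mvq vb a2 b2 _ mze.
  rewrite ge0_integralD_EFin//; last 2 first.
  - by move=> p; rewrite !addr_ge0.
  - by apply: measurable_funD; exact: measurable_funD.
  congr (_ + _).
  rewrite ge0_integralD_EFin; last 4 first.
  - by move=> p; rewrite !addr_ge0.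
  - by move=> p; rewrite !addr_ge0.
  - exact: measurable_funD.
  - exact: measurable_funD.
  rewrite (ge0_integralD_EFin _ x0 y0 mx my) (ge0_integralD_EFin _ z1 z2 mz1 mz2).
  rewrite !Ivq// addeA; congr (_ + _ + _ + _).
    by rewrite ge0_integralZ_EFin// (integral_joint QT mX) ?mule1.
  by rewrite ge0_integralZ_EFin// (integral_joint_out1 mX s20 D0 mD pYE).
rewrite LHSE -RHSE; apply: ge0_le_integral_EFin.
- by move=> p; rewrite !addr_ge0// vq0.
- move=> p; apply: le_trans (le_trans (le_ptw p) _).
    by rewrite le_eqVlt; apply/orP; left; apply/eqP; ring.
  by rewrite le_eqVlt; apply/orP; left; apply/eqP; ring.
- by apply: measurable_funD => //; apply: measurable_funD; exact: mvq.
- apply: measurable_funD => //; apply: measurable_funD.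
    by apply: measurable_funD; apply: measurable_funM.
  by apply: measurable_funD; exact: mvq.
Qed.

End CoreBound.

(** * Positivity and finiteness of integrals *)

Section BoundedIntegral.
Context d (T : measurableType d) (R : realType).

Lemma Rintegral_bounded (P : probability T R) (f : T -> R) (C : R) :
  (forall x, 0 <= f x) -> (forall x, f x <= C) -> measurable_fun setT f ->
  (Rintegral P setT f)%:E = (\int[P]_x (f x)%:E)%E /\ Rintegral P setT f <= C.
Proof.
move=> f0 fC mf; have le : (\int[P]_x (f x)%:E <= C%:E)%E.
  have <- : (\int[P]_x C%:E = C%:E)%E.
    by rewrite integral_cst//= probability_setT mule1.
  by apply: ge0_le_integral_EFin => // x; exact: le_trans (f0 x) (fC x).
have fin : (\int[P]_x (f x)%:E)%E \is a fin_num.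
  rewrite ge0_fin_numE ?(le_lt_trans le) ?ltry//.
  by apply: integral_ge0 => x _; rewrite lee_fin.
by rewrite /Rintegral fineK//; split => //; rewrite -lee_fin fineK.
Qed.

Lemma integral_gt0 (m : {measure set T -> \bar R}) (f : T -> R) :
  m setT != 0%E -> (forall x, 0 < f x) -> measurable_fun setT f ->
  (0 < \int[m]_x (f x)%:E)%E.
Proof.
move=> mT f0 mf; rewrite lt0e; apply/andP; split; last first.
  by apply: integral_ge0 => x _; rewrite lee_fin ltW.
apply: contra mT => /eqP I0.
have mE : measurable_fun setT (EFin \o f) by exact/measurable_EFinP.
have [+ _] := ae_eq_integral_abs m measurableT mE.
case.
  rewrite -[RHS]I0; apply: eq_integral => x _ /=.
  by rewrite ger0_norm// ltW.
move=> A [mA mA0 sA]; apply/eqP; apply: (subset_measure0 (B := A)) => //.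
move=> x _; apply: sA => /= /(_ I) [] fx0.
by have := f0 x; rewrite fx0 ltxx.
Qed.

End BoundedIntegral.

Lemma measurable_inv_gt0 d (T : measurableType d) (R : realType) (f : T -> R) :
  (forall x, 0 < f x) -> measurable_fun setT f ->
  measurable_fun setT (fun x => (f x)^-1).
Proof.
move=> f0 mf; rewrite (_ : (fun x => _) = expR \o (fun x => - ln (f x))).
  apply: measurableT_comp => //; apply: measurableT_comp => //.
  exact: measurableT_comp (@measurable_ln R) mf.
by apply/funext => x /=; rewrite expRN lnK ?posrE.
Qed.

(** * Output densities as mixtures over the encoders' randomness *)

Section Mixture.
Context {R : realType} d (O : measurableType d).
Variables (Q : {sigma_finite_measure set O -> \bar R}).
Hypothesis QT : Q setT = 1%E.
Variables (N : nat) (X : O -> 'I_N -> R).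
Hypothesis mX : forall i, measurable_fun setT (fun u => X u i).
Variables (v : R) (p : @Rn R N -> R).
Hypotheses (v0 : 0 < v).
Hypothesis pE : forall y,
  (p y)%:E = (\int[Q]_u (gdensN v (fun i => y i - X u i)%R)%:E)%E.

Local Notation Y := (@Rn R N).
Local Notation lam := (@lebesgue_n R N).
Local Open Scope ereal_scope.

Lemma measurable_mixture_kernel :
  measurable_fun setT (fun q : O * Y => gdensN v (fun i => q.2 i - X q.1 i)%R).
Proof.
apply: measurable_gdensN => i; apply: measurable_funB.
- exact: measurableT_comp (measurable_coord i) (@measurable_snd _ _ _ _).
- exact: measurableT_comp (mX i) (@measurable_fst _ _ _ _).
Qed.

Lemma mixture_gt0 y : (0 < p y)%R.
Proof.
rewrite -lte_fin pE; apply: integral_gt0; first by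
  rewrite (_ : _ setT = 1) ?onee_neq0//; exact: QT.
- by move=> u; exact: gdensN_gt0.
- exact: measurableT_comp measurable_mixture_kernel (pair2_measurable y).
Qed.

Lemma measurable_mixture : measurable_fun setT p.
Proof.
apply/measurable_EFinP; rewrite (_ : _ \o _ =
    fun y => \int[Q]_u (gdensN v (fun i => y i - X u i)%R)%:E); last first.
  by apply/funext => y /=; exact: pE.
apply: (measurable_integral_snd Q
  (f := fun q : O * Y => (gdensN v (fun i => q.2 i - X q.1 i)%R)%:E)).
- by move=> q; rewrite lee_fin gdensN_ge0.
- by apply/measurable_EFinP; exact: measurable_mixture_kernel.
Qed.

Lemma integral_mixture1 : \int[lam]_y (p y)%:E = 1.
Proof.
under eq_integral do rewrite pE.
pose f (q : O * Y) := (gdensN v (fun i => q.2 i - X q.1 i)%R)%:E.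
have f0 q : 0 <= f q by rewrite lee_fin gdensN_ge0.
have mf : measurable_fun setT f.
  by apply/measurable_EFinP; exact: measurable_mixture_kernel.
transitivity (\int[lam]_y \int[Q]_u f (u, y)); first by [].
rewrite -integral_prodm_swap// integral_prodm//.
transitivity (\int[Q]_u (1 : \bar R)).
  by apply: eq_integral => u _; exact: (integral_gdensN (X u) v0).
by rewrite integral_cst// mul1e; exact: QT.
Qed.

End Mixture.

(** * The mass of the weighted reference density *)

Section SumMixture.
Context {R : realType} d (O : measurableType d).
Variables (Q : {sigma_finite_measure set O -> \bar R}).
Hypothesis QT : Q setT = 1%E.
Variables (N : nat) (I : finType) (X : I -> O -> 'I_N -> R).
Hypothesis mX : forall j i, measurable_fun setT (fun u => X j u i).
Variables (v : R) (r : I -> @Rn R N -> R).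
Hypothesis v0 : 0 < v.
Hypothesis rE : forall j y,
  (r j y)%:E = (\int[Q]_u (gdensN v (fun i => y i - X j u i)%R)%:E)%E.

Local Notation Y := (@Rn R N).
Local Notation lam := (@lebesgue_n R N).
Local Notation lam2 := (prodm lam lam).
Local Open Scope ereal_scope.

Lemma measurable_sum_mixture : measurable_fun setT (fun z => \sum_j r j z)%R.
Proof.
by apply: measurable_sum => j; exact: (measurable_mixture (mX j) (rE j)).
Qed.

Lemma integral_sum_mixture : \int[lam]_z (\sum_j r j z)%R%:E = #|I|%:R%:E.
Proof.
under eq_integral do rewrite -sumEFin.
rewrite ge0_integral_sum//.
- rewrite (eq_bigr (fun=> (1 : \bar R))).
    by rewrite sumEFin sumr_const.
  by move=> j _; exact: (integral_mixture1 QT (mX j) v0 (rE j)).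
- by move=> j; apply/measurable_EFinP; exact: (measurable_mixture (mX j) (rE j)).
- by move=> j z _; rewrite lee_fin ltW//; exact: (mixture_gt0 QT (mX j) v0 (rE j)).
Qed.

(** This controls the term f * q. Integrating the randomness first turns the channel factor into
    [r j], which cancels the denominator of the reciprocal posterior. What remains depends on [j]
    only through the weight, and the weights sum to at most 2. *)
Lemma sum_mixture_le (g : I -> Y -> R) (k : Y * Y -> R) :
  (forall j y, 0 <= g j y)%R -> (forall j, measurable_fun setT (g j)) ->
  (forall y, \sum_j g j y <= 2)%R ->
  (forall q, 0 <= k q)%R -> measurable_fun setT k ->
  (forall z, \int[lam]_y (k (y, z))%:E = 1) ->
  \sum_j \int[Q]_u \int[lam2]_q (g j q.1 * ((\sum_l r l q.2) / r j q.2) *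
    gdensN v (fun i => q.2 i - X j u i) * k q)%R%:E <= (2 * #|I|%:R)%:E.
Proof.
move=> g0 mg g2 k0 mk k1.
pose T z := (\sum_l r l z)%R.
have r0 j z : (0 < r j z)%R by exact: (mixture_gt0 QT (mX j) v0 (rE j)).
have mr j : measurable_fun setT (r j) by exact: (measurable_mixture (mX j) (rE j)).
have T0 z : (0 <= T z)%R by apply: sumr_ge0 => l _; exact: ltW.
have mT : measurable_fun setT T by exact: measurable_sum_mixture.
have m1 (f : Y -> R) : measurable_fun setT f ->
    measurable_fun setT (fun q : Y * Y => f q.1).
  by move=> mf; exact: measurableT_comp mf (@measurable_fst _ _ _ _).
have m2 (f : Y -> R) : measurable_fun setT f ->
    measurable_fun setT (fun q : Y * Y => f q.2).
  by move=> mf; exact: measurableT_comp mf (@measurable_snd _ _ _ _).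
have mTr j : measurable_fun setT (fun z => T z / r j z)%R.
  by apply: measurable_funM => //; exact: measurable_inv_gt0.
have step j : \int[Q]_u \int[lam2]_q (g j q.1 * (T q.2 / r j q.2) *
    gdensN v (fun i => q.2 i - X j u i) * k q)%R%:E =
    \int[lam2]_q (g j q.1 * (T q.2 * k q))%R%:E.
  pose w (q : Y * Y) := (g j q.1 * (T q.2 / r j q.2) * k q)%R.
  have w0 q : (0 <= w q)%R by rewrite !mulr_ge0// invr_ge0 ltW.
  have mw : measurable_fun setT w.
    by apply: measurable_funM => //; apply: measurable_funM; [exact: (m1 _ (mg j))|exact: (m2 _ (mTr j))].
  pose F (a : O * (Y * Y)) := (gdensN v (fun i => a.2.2 i - X j a.1 i) * w a.2)%R%:E.
  have F0 a : 0 <= F a by rewrite lee_fin mulr_ge0 ?gdensN_ge0.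
  have mgk : measurable_fun setT (fun a : O * (Y * Y) =>
      gdensN v (fun i => a.2.2 i - X j a.1 i)%R).
    apply: measurable_gdensN => i; apply: measurable_funB.
    - exact: (measurable_out2 (measurable_coord i)).
    - exact: (measurable_in (mX j i)).
  have mF : measurable_fun setT F.
    apply/measurable_EFinP; apply: measurable_funM => //.
    exact: measurableT_comp mw (@measurable_snd _ _ _ _).
  transitivity (\int[Q]_u \int[lam2]_q F (u, q)).
    apply: eq_integral => u _; apply: eq_integral => q _.
    by rewrite /F /w /=; congr EFin; ring.
  rewrite -integral_prodm// integral_prodm_swap//; apply: eq_integral => q _.
  rewrite /F /=; rewrite ge0_integralZr_EFin//.
  - rewrite -rE -EFinM; congr EFin; rewrite /w; field.
    by rewrite gt_eqF.
  - by move=> u; exact: gdensN_ge0.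
  - exact: measurableT_comp mgk (pair2_measurable q).
rewrite (eq_bigr _ (fun j _ => step j)) -ge0_integral_sum//; last 2 first.
- move=> j; apply/measurable_EFinP; apply: measurable_funM; first exact: (m1 _ (mg j)).
  by apply: measurable_funM => //; exact: (m2 _ mT).
- by move=> j q _; rewrite lee_fin !mulr_ge0.
have Tk0 q : (0 <= T q.2 * k q)%R by rewrite mulr_ge0.
have mTk : measurable_fun setT (fun q : Y * Y => T q.2 * k q)%R.
  by apply: measurable_funM => //; exact: (m2 _ mT).
apply: (@le_trans _ _ (\int[lam2]_q (2 * (T q.2 * k q))%R%:E)).
  under eq_integral do rewrite sumEFin -mulr_suml.
  apply: ge0_le_integral_EFin.
  - by move=> q; rewrite mulr_ge0// sumr_ge0.
  - by move=> q; rewrite ler_wpM2r.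
  - by apply: measurable_funM => //; apply: measurable_sum => j; exact: (m1 _ (mg j)).
  - exact: measurable_funM.
have Tk1 : \int[lam2]_q (T q.2 * k q)%R%:E = #|I|%:R%:E.
  rewrite integral_prodm_swap; last 2 first.
  - by move=> q; rewrite lee_fin.
  - exact/measurable_EFinP.
  rewrite -integral_sum_mixture; apply: eq_integral => z _ /=.
  rewrite ge0_integralZ_EFin// ?k1 ?mule1//.
  exact: measurableT_comp mk (pair2_measurable z).
by rewrite ge0_integralZ_EFin// Tk1 -EFinM.
Qed.

End SumMixture.

Section SecondMoment.
Context d (T : measurableType d) (R : realType) (P : probability T R).
Local Open Scope ereal_scope.

(** The linear term is signed, so [f] has to be integrable. It is kept explicit because centring by
    the mean acts on this term in [power_centered]. *)
Lemma integral_shift_sqr (f : T -> R) (k : R) : measurable_fun setT f ->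
  \int[P]_x ((f x) ^+ 2)%:E < +oo ->
  \int[P]_x ((f x + k) ^+ 2)%:E =
  (fine (\int[P]_x ((f x) ^+ 2)%:E) + 2 * k * Rintegral P setT f + k ^+ 2)%R%:E.
Proof.
move=> mf foo.
have mf2 : measurable_fun setT (fun x => f x ^+ 2)%R by exact: measurable_funX.
have f20 x : (0 <= f x ^+ 2)%R by exact: sqr_ge0.
have i2 : P.-integrable setT (fun x => (f x ^+ 2)%:E).
  apply/integrableP; split; first exact/measurable_EFinP.
  by under eq_integral do rewrite gee0_abs ?lee_fin//.
have ic (c : R) : P.-integrable setT (fun=> c%:E).
  exact: finite_measure_integrable_cst.
have i1 : P.-integrable setT (fun x => (f x)%:E).
  (* Finite second moment suffices because the absolute value of f is at most 1 + f^2. *)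
  apply: (@le_integrable _ _ _ P setT _ _ (fun x => (1 + f x ^+ 2)%R%:E)) => //.
  - exact/measurable_EFinP.
  - move=> x _; rewrite /= lee_fin (ger0_norm (addr_ge0 ler01 (f20 x))).
    rewrite ler_norml; have := sqr_ge0 (f x + 1); have := sqr_ge0 (f x - 1).
    by have := f20 x; rewrite !sqrrD sqrrN; lra.
  - have -> : (fun x => (1 + f x ^+ 2)%R%:E) = (fun x => 1%:E + (f x ^+ 2)%:E).
      by apply/funext => x; rewrite EFinD.
    exact: integrableD.
have i1k : P.-integrable setT (fun x => (2 * k)%:E * (f x)%:E) by exact: integrableZl.
transitivity (\int[P]_x ((f x ^+ 2)%:E + ((2 * k)%:E * (f x)%:E + (k ^+ 2)%:E))).
  by apply: eq_integral => x _; rewrite -EFinM -!EFinD; congr EFin; ring.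
rewrite integralD//; last exact: integrableD.
have -> : \int[P]_x ((2 * k)%:E * (f x)%:E + (k ^+ 2)%:E) =
    (2 * k)%:E * \int[P]_x (f x)%:E + (k ^+ 2)%:E.
  rewrite integralD// integralZl//; congr (_ + _).
  by rewrite integral_cst//= probability_setT mule1.
have fin1 : \int[P]_x (f x)%:E \is a fin_num by exact: integrable_fin_num.
have fin2 : \int[P]_x (f x ^+ 2)%:E \is a fin_num by exact: integrable_fin_num.
by rewrite /Rintegral -(fineK fin1) -(fineK fin2) -EFinM -!EFinD addrA.
Qed.

End SecondMoment.

(** At most one index is correct and contributes 1; the wrong ones contribute at most 1 together. *)
Lemma sum_weight_le2 {R : realType} (I : finType) (b : I -> bool) :
  (forall i j, b i -> b j -> i = j) ->
  \sum_i ((b i)%:R + (~~ b i)%:R / #|I|%:R) <= 2 :> R.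
Proof.
move=> b1; rewrite big_split/= -[2%R]/(1 + 1)%R lerD//.
  have [/existsP[i bi]|/existsPn nb] := boolP [exists i, b i].
    rewrite (bigD1 i)//= bi big1 ?addr0// => j ji.
    by case: (boolP (b j)) => // bj; rewrite (b1 _ _ bi bj) eqxx in ji.
  by rewrite big1// => i _; rewrite (negbTE (nb i)).
rewrite -mulr_suml; have [->|I0] := eqVneq #|I| 0%N; first by rewrite invr0 mulr0.
rewrite ler_pdivrMr ?ltr0n ?lt0n// mul1r -[leRHS](sumr_const I 1%R).
by apply: ler_sum => i _; case: (b i).
Qed.

Lemma sume_const_ord {R : realType} n (x : \bar R) :
  (\sum_(i < n) x = n%:R%:E * x)%E.
Proof.
rewrite mule_natl; elim: n => [|n IH]; first by rewrite big_ord0.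
by rewrite big_ord_recl IH -muleS.
Qed.

(** * Random codes: output densities and power of the inputs *)

Section Code.
Context {R : realType} (N M1 M2 : nat) {d1 d2 : measure_display}
  {O1 : measurableType d1} {O2 : measurableType d2}
  (Q1 : probability O1 R) (Q2 : probability O2 R)
  (enc1 : 'I_M1 -> O1 -> 'I_N -> R) (enc2 : 'I_M2 -> O2 -> 'I_N -> R).
Hypothesis menc1 : forall w i, measurable_fun setT (fun u => enc1 w u i).
Hypothesis menc2 : forall w i, measurable_fun setT (fun u => enc2 w u i).

Definition randm := prodm Q1 Q2.

Definition input (w : 'I_M1 * 'I_M2) (u : O1 * O2) (i : 'I_N) : R :=
  enc1 w.1 u.1 i + enc2 w.2 u.2 i.

Local Notation W := ('I_M1 * 'I_M2)%type.
Local Notation Y := (@Rn R N).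
Local Notation lam := (@lebesgue_n R N).

Lemma randmT : randm setT = 1%E.
Proof.
transitivity (\int[randm]_u 1%:E)%E; first by rewrite integral_cst//= mul1e.
rewrite /randm integral_prodm//.
transitivity (\int[Q1]_u 1%:E)%E.
  by apply: eq_integral => u _; rewrite integral_cst//= probability_setT mule1.
by rewrite integral_cst//= probability_setT mule1.
Qed.

Lemma measurable_enc1 w i : measurable_fun setT (fun u : O1 * O2 => enc1 w u.1 i).
Proof. exact: measurableT_comp (menc1 w i) (@measurable_fst _ _ _ _). Qed.

Lemma measurable_enc2 w i : measurable_fun setT (fun u : O1 * O2 => enc2 w u.2 i).
Proof. exact: measurableT_comp (menc2 w i) (@measurable_snd _ _ _ _). Qed.

Lemma measurable_input w i : measurable_fun setT (fun u => input w u i).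
Proof. by apply: measurable_funD; [exact: measurable_enc1|exact: measurable_enc2]. Qed.

(** The integrand is bounded by a power of the Gaussian peak value, so the [fine] hidden in both
    [Rintegral]s loses nothing. *)
Lemma out_densE v w (y : Y) : 0 < v ->
  (out_dens Q1 Q2 enc1 enc2 v w.1 w.2 y)%:E =
  (\int[randm]_u (gdensN v (fun i => y i - input w u i)%R)%:E)%E.
Proof.
move=> v0; pose C := (Num.sqrt (pi * v *+ 2))^-1 ^+ N.
pose f (u : O1 * O2) := gdensN v (fun i => y i - input w u i).
have mf : measurable_fun setT f.
  apply: measurable_gdensN => i; apply: measurable_funB => //.
  exact: measurable_input.
have fE u1 u2 : \prod_(i < N) gdens v (y i - enc1 w.1 u1 i - enc2 w.2 u2 i) = f (u1, u2).
  by apply: eq_bigr => i _; rewrite /input opprD addrA.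
have f0 u : 0 <= f u by exact: gdensN_ge0.
have fC u : f u <= C by exact: gdensN_le.
have in2 u1 := @Rintegral_bounded _ _ _ Q2 (fun u2 => f (u1, u2)) C
  (fun u2 => f0 _) (fun u2 => fC _) (measurableT_comp mf (pair1_measurable u1)).
have mi : measurable_fun setT (fun u1 => Rintegral Q2 setT (fun u2 => f (u1, u2))).
  apply/measurable_EFinP.
  rewrite (_ : _ \o _ = fun u1 => (\int[Q2]_u2 (f (u1, u2))%:E)%E); last first.
    by apply/funext => u1 /=; exact: (in2 u1).1.
  apply: (measurable_integral_fst Q2 (f := fun u => (f u)%:E)).
  - by move=> u; rewrite lee_fin.
  - exact/measurable_EFinP.
rewrite /out_dens.
have -> : (fun u1 => Rintegral Q2 setT (fun u2 =>
    \prod_(i < N) gdens v (y i - enc1 w.1 u1 i - enc2 w.2 u2 i))) =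
    (fun u1 => Rintegral Q2 setT (fun u2 => f (u1, u2))).
  by apply/funext => u1; apply: eq_Rintegral => u2 _; exact: fE.
rewrite (Rintegral_bounded Q1 (C := C) _ _ mi).1.
- rewrite /randm integral_prodm//.
  + by apply: eq_integral => u1 _; exact: (in2 u1).1.
  + exact/measurable_EFinP.
- by move=> u1; apply: Rintegral_ge0.
- by move=> u1; exact: (in2 u1).2.
Qed.

Local Open Scope ereal_scope.

Lemma integral_randm_fst (f : O1 -> R) : (forall u, (0 <= f u)%R) ->
  measurable_fun setT f -> \int[randm]_u (f u.1)%:E = \int[Q1]_u (f u)%:E.
Proof.
move=> f0 mf; rewrite /randm integral_prodm.
- by apply: eq_integral => u _ /=; rewrite integral_cst//= probability_setT mule1.
- by move=> u; rewrite lee_fin.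
- by apply/measurable_EFinP; exact: measurableT_comp mf (@measurable_fst _ _ _ _).
Qed.

Lemma integral_randm_snd (f : O2 -> R) : (forall u, (0 <= f u)%R) ->
  measurable_fun setT f -> \int[randm]_u (f u.2)%:E = \int[Q2]_u (f u)%:E.
Proof.
move=> f0 mf; rewrite /randm integral_prodm_swap.
- by apply: eq_integral => u _ /=; rewrite integral_cst//= probability_setT mule1.
- by move=> u; rewrite lee_fin.
- by apply/measurable_EFinP; exact: measurableT_comp mf (@measurable_snd _ _ _ _).
Qed.

Let sqr1_ge0 w u : (0 <= \sum_(i < N) enc1 w u i ^+ 2)%R.
Proof. by apply: sumr_ge0 => i _; exact: sqr_ge0. Qed.
Let sqr2_ge0 w u : (0 <= \sum_(i < N) enc2 w u i ^+ 2)%R.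
Proof. by apply: sumr_ge0 => i _; exact: sqr_ge0. Qed.
Let msqr1 w : measurable_fun setT (fun u => \sum_(i < N) enc1 w u i ^+ 2)%R.
Proof. by apply: measurable_sum => i; exact: measurable_funX. Qed.
Let msqr2 w : measurable_fun setT (fun u => \sum_(i < N) enc2 w u i ^+ 2)%R.
Proof. by apply: measurable_sum => i; exact: measurable_funX. Qed.

Variables P1 P2 : R.
Hypothesis power1 : \sum_(w < M1) \int[Q1]_u ((\sum_(i < N) enc1 w u i ^+ 2)%R%:E) <=
  (M1%:R * N%:R * P1)%R%:E.
Hypothesis power2 : \sum_(w < M2) \int[Q2]_u ((\sum_(i < N) enc2 w u i ^+ 2)%R%:E) <=
  (M2%:R * N%:R * P2)%R%:E.

Lemma power1_pair :
  \sum_(w : W) \int[randm]_u (\sum_(i < N) enc1 w.1 u.1 i ^+ 2)%R%:E <=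
  (M1%:R * M2%:R * (N%:R * P1))%R%:E.
Proof.
rewrite -(pair_bigA _ (fun w1 w2 =>
  \int[randm]_u (\sum_(i < N) enc1 w1 u.1 i ^+ 2)%R%:E))/=.
rewrite (eq_bigr (fun w1 => M2%:R%:E *
  \int[Q1]_u (\sum_(i < N) enc1 w1 u i ^+ 2)%R%:E)); last first.
  move=> w1 _; rewrite sume_const_ord.
  by rewrite (integral_randm_fst (sqr1_ge0 w1) (msqr1 w1)).
rewrite -ge0_sume_distrr; last first.
  by move=> w _; apply: integral_ge0 => u _; rewrite lee_fin.
apply: le_trans (lee_wpmul2l _ power1) _; first by rewrite lee_fin.
by rewrite -EFinM lee_fin le_eqVlt; apply/orP; left; apply/eqP; ring.
Qed.

Lemma power2_pair :
  \sum_(w : W) \int[randm]_u (\sum_(i < N) enc2 w.2 u.2 i ^+ 2)%R%:E <=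
  (M1%:R * M2%:R * (N%:R * P2))%R%:E.
Proof.
rewrite -(pair_bigA _ (fun w1 w2 =>
  \int[randm]_u (\sum_(i < N) enc2 w2 u.2 i ^+ 2)%R%:E))/=.
rewrite (eq_bigr (fun w1 => \sum_(w2 < M2)
  \int[Q2]_u (\sum_(i < N) enc2 w2 u i ^+ 2)%R%:E)); last first.
  move=> w1 _; apply: eq_bigr => w2 _.
  by rewrite (integral_randm_snd (sqr2_ge0 w2) (msqr2 w2)).
rewrite sume_const_ord.
apply: le_trans (lee_wpmul2l _ power2) _; first by rewrite lee_fin.
by rewrite -EFinM lee_fin le_eqVlt; apply/orP; left; apply/eqP; ring.
Qed.

(* Removing the mean of the second input from the sum kills the correlation
   of the two inputs, which the power constraints do not control. *)
Lemma power_centered : (0 < M2)%N -> exists mu : 'I_N -> R,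
  \sum_(w : W) \int[randm]_u (\sum_(i < N) (input w u i - mu i) ^+ 2)%R%:E <=
  (M1%:R * M2%:R * (N%:R * (P1 + P2)))%R%:E.
Proof.
move=> M20.
have fin2 w i : \int[Q2]_u (enc2 w u i ^+ 2)%:E < +oo.
  apply: le_lt_trans (ltry (M2%:R * N%:R * P2)%R); apply: le_trans power2.
  rewrite (bigD1 w)//=.
  apply: (@le_trans _ _ (\int[Q2]_u (\sum_(i < N) enc2 w u i ^+ 2)%R%:E)).
    apply: ge0_le_integral_EFin => //.
    - by move=> u; exact: sqr_ge0.
    - move=> u; rewrite (bigD1 i)//= lerDl; apply: sumr_ge0 => j _.
      exact: sqr_ge0.
    - exact: measurable_funX.
  rewrite leeDl//; apply: sume_ge0 => w' _; apply: integral_ge0 => u _.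
  by rewrite lee_fin.
pose mu i := (M2%:R^-1 * \sum_(w < M2) Rintegral Q2 setT (fun u => enc2 w u i))%R.
exists mu.
have m20 : (M2%:R != 0 :> R)%R by rewrite pnatr_eq0 -lt0n.
(* On average over message and randomness the square is the second moment plus c^2 - mu_i^2, and the
   last term is dropped. The constant [c] will be the input of user 1, which is fixed at that
   stage. *)
have var c i : \sum_(w < M2) \int[Q2]_u ((enc2 w u i + (c - mu i)) ^+ 2)%R%:E <=
    (M2%:R * c ^+ 2)%:E + \sum_(w < M2) \int[Q2]_u (enc2 w u i ^+ 2)%:E.
  rewrite (eq_bigr _ (fun w _ => integral_shift_sqr (c - mu i) (menc2 w i) (fin2 w i))).
  have fink w : \int[Q2]_u (enc2 w u i ^+ 2)%:E =
      (fine (\int[Q2]_u (enc2 w u i ^+ 2)%:E))%:E.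
    rewrite fineK// ge0_fin_numE//; apply: integral_ge0 => u _.
    by rewrite lee_fin sqr_ge0.
  rewrite [X in _ <= _ + X](eq_bigr _ (fun w _ => fink w)) !sumEFin -EFinD lee_fin.
  rewrite !big_split/= -mulr_sumr sumr_const card_ord -[(_ *+ M2)%R]mulr_natl.
  have -> : (\sum_(w < M2) Rintegral Q2 setT (fun u => enc2 w u i) = M2%:R * mu i)%R.
    by rewrite /mu mulrA divff// mul1r.
  set A := (\sum_(w < M2) _)%R.
  have := mulr_ge0 (ler0n R M2) (sqr_ge0 (mu i)); nra.
have msq (w1 : 'I_M1) (w2 : 'I_M2) : measurable_fun setT (fun u : O1 * O2 =>
    \sum_(i < N) (input (w1, w2) u i - mu i) ^+ 2)%R.
  apply: measurable_sum => i; apply: measurable_funX.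
  by apply: measurable_funB => //; exact: measurable_input.
have sq0 w1 w2 u : (0 <= \sum_(i < N) (input (w1, w2) u i - mu i) ^+ 2)%R.
  by apply: sumr_ge0 => i _; exact: sqr_ge0.
rewrite -(pair_bigA _ (fun w1 w2 =>
  \int[randm]_u (\sum_(i < N) (input (w1, w2) u i - mu i) ^+ 2)%R%:E))/=.
pose S2 := \sum_(w < M2) \int[Q2]_u (\sum_(i < N) enc2 w u i ^+ 2)%R%:E.
have S20 : 0 <= S2.
  by apply: sume_ge0 => w _; apply: integral_ge0 => u _; rewrite lee_fin.
have S2E : S2 = \sum_(i < N) \sum_(w < M2) \int[Q2]_u (enc2 w u i ^+ 2)%:E.
  rewrite exchange_big/=; apply: eq_bigr => w _.
  under eq_integral do rewrite -sumEFin.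
  rewrite ge0_integral_sum//.
  - by move=> i; apply/measurable_EFinP; exact: measurable_funX.
  - by move=> i u _; rewrite lee_fin sqr_ge0.
have S2fin : S2 = (fine S2)%:E.
  by rewrite fineK// ge0_fin_numE//; exact: le_lt_trans power2 (ltry _).
have step w1 : \sum_(w2 < M2) \int[randm]_u
    (\sum_(i < N) (input (w1, w2) u i - mu i) ^+ 2)%R%:E <=
    M2%:R%:E * \int[Q1]_u (\sum_(i < N) enc1 w1 u i ^+ 2)%R%:E + S2.
  rewrite (eq_bigr (fun w2 => \int[Q1]_u1 \int[Q2]_u2
      (\sum_(i < N) (input (w1, w2) (u1, u2) i - mu i) ^+ 2)%R%:E)); last first.
    move=> w2 _; rewrite /randm integral_prodm; first by [].
    - by move=> u; rewrite lee_fin.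
    - exact/measurable_EFinP.
  rewrite -ge0_integral_sum//; last 2 first.
  - move=> w2; apply: (measurable_integral_fst Q2 (f := fun u : O1 * O2 =>
      (\sum_(i < N) (input (w1, w2) u i - mu i) ^+ 2)%R%:E)).
      by move=> u; rewrite lee_fin.
    exact/measurable_EFinP.
  - by move=> w2 u1 _; apply: integral_ge0 => u2 _; rewrite lee_fin.
  apply: (@le_trans _ _ (\int[Q1]_u1
      (M2%:R * (\sum_(i < N) enc1 w1 u1 i ^+ 2) + fine S2)%R%:E)); last first.
    have M2sq0 u : (0 <= M2%:R * (\sum_(i < N) enc1 w1 u i ^+ 2))%R.
      by rewrite mulr_ge0.
    rewrite S2fin (ge0_integralD_EFin _ M2sq0 (fun _ => fine_ge0 S20)
      (measurable_funM (measurable_cst _) (msqr1 w1)) (measurable_cst _)).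
    by rewrite ge0_integralZ_EFin// integral_cst//= probability_setT mule1.
  apply: ge0_le_integral => //.
  - by move=> u1 _; apply: sume_ge0 => w2 _; apply: integral_ge0 => u2 _;
      rewrite lee_fin.
  - apply: emeasurable_sum => w2.
    apply: (measurable_integral_fst Q2 (f := fun u : O1 * O2 =>
      (\sum_(i < N) (input (w1, w2) u i - mu i) ^+ 2)%R%:E)).
      by move=> u; rewrite lee_fin.
    exact/measurable_EFinP.
  - by apply/measurable_EFinP; apply: measurable_funD => //; exact: measurable_funM.
  move=> u1 _.
  rewrite EFinD -S2fin S2E mulr_sumr -sumEFin -big_split/=.
  rewrite (eq_bigr (fun w2 => \sum_(i < N) \int[Q2]_u2
      ((enc2 w2 u2 i + (enc1 w1 u1 i - mu i)) ^+ 2)%R%:E)); last first.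
    move=> w2 _; rewrite -ge0_integral_sum//.
    - apply: eq_integral => u2 _; rewrite sumEFin; congr EFin.
      by apply: eq_bigr => i _; rewrite /input /=; congr (_ ^+ 2)%R; ring.
    - move=> i; apply/measurable_EFinP; apply: measurable_funX.
      exact: measurable_funD.
    - by move=> i u2 _; rewrite lee_fin sqr_ge0.
  by rewrite exchange_big/=; apply: lee_sum => i _; exact: var.
apply: le_trans (lee_sum _ (fun w1 _ => step w1)) _.
rewrite big_split/= sume_const_ord -ge0_sume_distrr; last first.
  by move=> w _; apply: integral_ge0 => u _; rewrite lee_fin.
apply: le_trans (leeD (lee_wpmul2l _ power1) (lee_wpmul2l _ power2)) _;
  try by rewrite lee_fin.
by rewrite -!EFinM -EFinD lee_fin le_eqVlt; apply/orP; left; apply/eqP; ring.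
Qed.

End Code.

Lemma lee_sum5 {R : realType} (I : finType) (f a b c d : I -> \bar R) (n k : \bar R) :
  (forall i, f i + n <= k + a i + b i + c i + d i)%E ->
  (\sum_i f i + \sum_(i : I) n <=
   \sum_(i : I) k + \sum_i a i + \sum_i b i + \sum_i c i + \sum_i d i)%E.
Proof. by move=> h; rewrite -!big_split/=; apply: lee_sum => i _. Qed.

Lemma sum_adde {R : realType} (I : finType) (a b : I -> \bar R) :
  (\sum_i (a i + b i) = \sum_i a i + \sum_i b i)%E.
Proof. exact: big_split. Qed.

(** * The converse inequalities for a single code *)

Section Converse.
Context {R : realType} (N M1 M2 : nat) {d1 d2 : measure_display}
  {O1 : measurableType d1} {O2 : measurableType d2}
  (Q1 : probability O1 R) (Q2 : probability O2 R)
  (enc1 : 'I_M1 -> O1 -> 'I_N -> R) (enc2 : 'I_M2 -> O2 -> 'I_N -> R)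
  (dec : @Rn R N -> 'I_M1 * 'I_M2).
Hypothesis menc1 : forall w i, measurable_fun setT (fun u => enc1 w u i).
Hypothesis menc2 : forall w i, measurable_fun setT (fun u => enc2 w u i).
Hypothesis mdec : forall w, measurable (dec @^-1` [set w]).
Variables s1 s2 P1 P2 eps : R.
Hypotheses (s10 : 0 < s1) (s20 : 0 < s2) (P10 : 0 < P1) (P20 : 0 < P2).
Hypotheses (M10 : (0 < M1)%N) (M20 : (0 < M2)%N).

Local Notation W := ('I_M1 * 'I_M2)%type.
Local Notation Y := (@Rn R N).
Local Notation O := (O1 * O2)%type.
Local Notation lam := (@lebesgue_n R N).
Local Notation lam2 := (prodm lam lam).
Local Notation Q := (randm Q1 Q2).
Local Notation X := (input enc1 enc2).
Local Notation M := (M1%:R * M2%:R : R).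
Let pY (w : W) : Y -> R := out_dens Q1 Q2 enc1 enc2 s1 w.1 w.2.
Let pZ (w : W) : Y -> R := out_dens Q1 Q2 enc1 enc2 (s1 + s2) w.1 w.2.

Hypothesis power1 : (\sum_(w < M1) \int[Q1]_u ((\sum_(i < N) enc1 w u i ^+ 2)%R%:E) <=
  (M1%:R * N%:R * P1)%R%:E)%E.
Hypothesis power2 : (\sum_(w < M2) \int[Q2]_u ((\sum_(i < N) enc2 w u i ^+ 2)%R%:E) <=
  (M2%:R * N%:R * P2)%R%:E)%E.
Hypothesis error : (\sum_(w : W) \int[lam]_y (pY w y * (dec y != w)%:R)%R%:E <=
  (M * eps)%:E)%E.

Let s0 : 0 < s1 + s2. Proof. by rewrite addr_gt0. Qed.
Let m10 : 0 < M1%:R :> R. Proof. by rewrite ltr0n. Qed.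
Let m20 : 0 < M2%:R :> R. Proof. by rewrite ltr0n. Qed.
Let M0 : 0 < M. Proof. exact: mulr_gt0. Qed.
Let mX w i : measurable_fun setT (fun u => X w u i).
Proof. exact: measurable_input. Qed.
Let pZE w z : (pZ w z)%:E =
  (\int[Q]_u (gdensN (s1 + s2) (fun i => z i - X w u i)%R)%:E)%E.
Proof. exact: out_densE. Qed.
Let pZ_gt0 w z : 0 < pZ w z.
Proof. exact: (mixture_gt0 (randmT Q1 Q2) (mX w) s0 (pZE w)). Qed.
Let measurable_pZ w : measurable_fun setT (pZ w).
Proof. exact: (measurable_mixture (mX w) (pZE w)). Qed.
Let cardW : #|{: W}|%:R = M.
Proof. by rewrite card_prod !card_ord natrM. Qed.

Let sumW (c : R) : \sum_(w : W) c = M * c.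
Proof. by rewrite -cardW sumr_const mulr_natl. Qed.

(** With [m] the number of candidate messages the total mass is at most 2 rather than 1, and the
    logarithm is exactly - ln m times the error indicator. *)
Definition weight (b : bool) (m : R) : R := b%:R + (~~ b)%:R / m.

Let weight_gt0 b m : 0 < m -> 0 < weight b m.
Proof.
by move=> m0; rewrite /weight; case: b; rewrite /= ?mul0r ?addr0 ?add0r ?mul1r ?invr_gt0.
Qed.

Let ln_weight b m : 0 < m -> ln (weight b m) = - ((~~ b)%:R * ln m).
Proof.
move=> m0; rewrite /weight; case: b => /=.
  by rewrite !mul0r addr0 ln1 oppr0.
by rewrite add0r !mul1r lnV.
Qed.

Let measurable_correct w : measurable_fun setT (fun y : Y => (dec y == w)%:R : R).
Proof.
rewrite (_ : (fun y => _) = \1_(dec @^-1` [set w])); first exact: measurable_indic.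
apply/funext => y; rewrite indicE; congr (_%:R); congr nat_of_bool.
by apply/eqP/idP => [yw|]; rewrite inE.
Qed.

Let measurable_wrong w : measurable_fun setT (fun y : Y => (dec y != w)%:R : R).
Proof.
rewrite (_ : (fun y => _) = (fun y : Y => 1 - (dec y == w)%:R)).
  exact: measurable_funB.
by apply/funext => y; case: eqP => _; rewrite /= ?subrr ?subr0.
Qed.

Let measurable_weight w m : measurable_fun setT (fun y : Y => weight (dec y == w) m).
Proof. by apply: measurable_funD => //; exact: measurable_funM. Qed.

(** In every use the first factor is a density of Y given Z and the second a density of Z, centred
    at inputs or constants. They are written in the noises so that the logarithms are forms
    [quad]. *)
Definition refdens (va vb a1 b1 a2 b2 : R) (xi ze : O -> 'I_N -> R) (w : W)
    (p : O * (Y * Y)) : R :=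
  gdensN va (fun i => a1 * (p.2.1 i - X w p.1 i) + b1 * (p.2.2 i - p.2.1 i) + xi p.1 i) *
  gdensN vb (fun i => a2 * (p.2.1 i - X w p.1 i) + b2 * (p.2.2 i - p.2.1 i) + ze p.1 i).

Let measurable_affine w a b (xi : O -> 'I_N -> R) i :
  measurable_fun setT (fun u => xi u i) -> measurable_fun setT
  (fun p : O * (Y * Y) => a * (p.2.1 i - X w p.1 i) + b * (p.2.2 i - p.2.1 i) + xi p.1 i).
Proof.
move=> mxi; apply: measurable_funD; last exact: (measurable_in mxi).
apply: measurable_funD; apply: measurable_funM => //; apply: measurable_funB.
- exact: (measurable_out1 (measurable_coord i)).
- exact: (measurable_in (mX w i)).
- exact: (measurable_out2 (measurable_coord i)).
- exact: (measurable_out1 (measurable_coord i)).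
Qed.

Let refdens_ge0 va vb a1 b1 a2 b2 xi ze w p : 0 <= refdens va vb a1 b1 a2 b2 xi ze w p.
Proof. by rewrite mulr_ge0 ?gdensN_ge0. Qed.

Let measurable_refdens va vb a1 b1 a2 b2 (xi ze : O -> 'I_N -> R) w :
  (forall i, measurable_fun setT (fun u => xi u i)) ->
  (forall i, measurable_fun setT (fun u => ze u i)) ->
  measurable_fun setT (refdens va vb a1 b1 a2 b2 xi ze w).
Proof.
move=> mxi mze; apply: measurable_funM; apply: measurable_gdensN => i;
  exact: measurable_affine.
Qed.

Local Open Scope ereal_scope.

(** If [v] is at least the average second moment per coordinate, the normalised form contributes at
    most N/2 per message pair. Two such forms balance the summand [N] of [core_bound]. *)
Let quad_sum (a b V v : R) (xi : W -> O -> 'I_N -> R) : (0 < v)%R ->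
  (forall w i, measurable_fun setT (fun u => xi w u i)) ->
  (a ^+ 2 * s1 + b ^+ 2 * s2 + V <= v)%R ->
  \sum_(w : W) \int[Q]_u (\sum_(i < N) xi w u i ^+ 2)%R%:E <= (M * (N%:R * V))%R%:E ->
  \sum_(w : W) ((v *+ 2)^-1)%:E * \int[Q]_u
    (N%:R * (a ^+ 2 * s1 + b ^+ 2 * s2) + \sum_(i < N) xi w u i ^+ 2)%R%:E <=
  (M * (N%:R / 2))%R%:E.
Proof.
move=> v0 mxi le_v le_V.
have c0 : (0 <= N%:R * (a ^+ 2 * s1 + b ^+ 2 * s2))%R.
  by rewrite mulr_ge0// addr_ge0// mulr_ge0 ?sqr_ge0// ltW.
have x0 w u : (0 <= \sum_(i < N) xi w u i ^+ 2)%R.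
  by apply: sumr_ge0 => i _; exact: sqr_ge0.
have mx w : measurable_fun setT (fun u => \sum_(i < N) xi w u i ^+ 2)%R.
  by apply: measurable_sum => i; exact: measurable_funX.
rewrite -ge0_sume_distrr; last first.
  by move=> w _; apply: integral_ge0 => u _; rewrite lee_fin addr_ge0.
rewrite (eq_bigr (fun w => (N%:R * (a ^+ 2 * s1 + b ^+ 2 * s2))%:E +
    \int[Q]_u (\sum_(i < N) xi w u i ^+ 2)%R%:E)); last first.
  move=> w _; rewrite (ge0_integralD_EFin _ (fun=> c0) (x0 w) (measurable_cst _) (mx w)).
  congr (_ + _); rewrite integral_cst//= (_ : _ setT = 1) ?mule1//.
  exact: randmT.
rewrite sum_adde sumEFin sumW.
have h0 : (0 <= (v *+ 2)^-1)%R by rewrite invr_ge0 mulrn_wge0// ltW.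
apply: (@le_trans _ _ (((v *+ 2)^-1)%:E *
  ((M * (N%:R * (a ^+ 2 * s1 + b ^+ 2 * s2)))%R%:E + (M * (N%:R * V))%R%:E))).
  by apply: lee_wpmul2l; rewrite ?lee_fin// leeD2l.
rewrite -EFinD -EFinM lee_fin -!mulrDr mulrC ler_pdivrMr ?mulrn_wgt0//.
rewrite (_ : M * (N%:R / 2) * (v *+ 2) = M * (N%:R * v))%R; last by field.
by rewrite ler_wpM2l ?(ltW M0)// ler_wpM2l.
Qed.

(** The common template of the three bounds. [h] is the quantity to be averaged and [g] the
    reciprocal posterior that enters the test function; [l] and [x] absorb the difference between
    [h] and ln g. [E1] bounds the mass of the weighted reference density and [E2] that of the
    correction [x]. The hypothesis s1 * s2 <= va * vb makes the logarithmic constant nonnegative, as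
    Tonelli requires. *)
Lemma converse (g h x : W -> Y -> R) (m l va vb a1 b1 a2 b2 V1 V2 E1 E2 : R)
    (xi ze : W -> O -> 'I_N -> R) :
  (1 <= m)%R -> (0 <= l)%R -> (0 < va)%R -> (0 < vb)%R -> (s1 * s2 <= va * vb)%R ->
  (forall w z, 0 < g w z)%R -> (forall w, measurable_fun setT (g w)) ->
  (forall w z, 0 <= h w z)%R -> (forall w, measurable_fun setT (h w)) ->
  (forall w z, 0 <= x w z)%R -> (forall w, measurable_fun setT (x w)) ->
  (forall w z, h w z <= ln (g w z) + l + x w z)%R ->
  (forall w i, measurable_fun setT (fun u => xi w u i)) ->
  (forall w i, measurable_fun setT (fun u => ze w u i)) ->
  (a1 ^+ 2 * s1 + b1 ^+ 2 * s2 + V1 <= va)%R ->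
  (a2 ^+ 2 * s1 + b2 ^+ 2 * s2 + V2 <= vb)%R ->
  \sum_(w : W) \int[Q]_u (\sum_(i < N) xi w u i ^+ 2)%R%:E <= (M * (N%:R * V1))%R%:E ->
  \sum_(w : W) \int[Q]_u (\sum_(i < N) ze w u i ^+ 2)%R%:E <= (M * (N%:R * V2))%R%:E ->
  \sum_(w : W) \int[jointm Q N]_p (weight (dec p.2.1 == w) m * g w p.2.2 *
     refdens va vb a1 b1 a2 b2 (xi w) (ze w) w p)%R%:E <= E1%:E ->
  \sum_(w : W) \int[lam]_z (pZ w z * x w z)%R%:E <= E2%:E ->
  \sum_(w : W) \int[lam]_z (pZ w z * h w z)%R%:E <=
  (M * (N%:R * (2^-1 * ln (va * vb / (s1 * s2))) + l + ln m * eps) + (E1 + E2))%R%:E.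
Proof.
move=> m1 l0 va0 vb0 vab g0 mg h0 mh x0 mx hg mxi mze le_va le_vb xiV zeV le_E1 le_E2.
have mm0 : (0 < m)%R by rewrite (lt_le_trans _ m1).
have L0 : (0 <= ln m)%R by exact: ln_ge0.
set c := (N%:R * (2^-1 * ln (va * vb / (s1 * s2))))%R.
have c0 : (0 <= c)%R.
  rewrite mulr_ge0// mulr_ge0// ln_ge0//.
  by rewrite ler_pdivlMr ?mul1r// mulr_gt0.
pose e1 w p := (weight (dec p.2.1 == w) m * g w p.2.2 *
     refdens va vb a1 b1 a2 b2 (xi w) (ze w) w p)%R.
pose e2 w p := (joint (X w) s1 s2 p * x w p.2.2)%R.
have e10 w p : (0 <= e1 w p)%R.
  apply: mulr_ge0; last exact: refdens_ge0.
  by apply: mulr_ge0; apply: ltW => //; exact: weight_gt0.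
have me1 w : measurable_fun setT (e1 w).
  apply: measurable_funM; last exact: measurable_refdens.
  apply: measurable_funM; last exact: (measurable_out2 (mg w)).
  exact: (measurable_out1 (measurable_weight w m)).
have e20 w p : (0 <= e2 w p)%R by rewrite mulr_ge0 ?joint_ge0.
have me2 w : measurable_fun setT (e2 w).
  apply: measurable_funM; last exact: (measurable_out2 (mx w)).
  exact: (measurable_joint (mX w)).
have D0 w y : (0 <= (dec y != w)%:R :> R)%R by exact: ler0n.
have ptw w p : (joint (X w) s1 s2 p * (h w p.2.2
      + quad (X w) 1 0 (fun _ _ => 0) p / (s1 *+ 2)
      + quad (X w) 0 1 (fun _ _ => 0) p / (s2 *+ 2)) <=
    joint (X w) s1 s2 p * (c + l + ln m * (dec p.2.1 != w)%:R
      + quad (X w) a1 b1 (xi w) p / (va *+ 2)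
      + quad (X w) a2 b2 (ze w) p / (vb *+ 2)) + (e1 w p + e2 w p))%R.
  have f0 : (0 < weight (dec p.2.1 == w) m * g w p.2.2)%R.
    by rewrite mulr_gt0// weight_gt0.
  have := joint_ln_le (X w) s10 s20 a1 b1 a2 b2 (xi w) (ze w) p va0 vb0 f0.
  rewrite lnM ?posrE ?weight_gt0// ln_weight// -/c -/(refdens _ _ _ _ _ _ _ _ _ _) -/(e1 w p).
  have := ler_wpM2l (joint_ge0 (X w) s1 s2 p) (hg w p.2.2).
  rewrite /e2 !mulrDr; lra.
have core w := core_bound (randmT Q1 Q2) (mX w) s10 s20
  (fun y => out_densE Q1 Q2 menc1 menc2 w y s10) (pZE w) (h0 w) (mh w) (D0 w)
  (measurable_wrong w) (fun p => addr_ge0 (e10 w p) (e20 w p))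
  (measurable_funD (me1 w) (me2 w)) (mxi w) (mze w)
  (addr_ge0 c0 l0) L0 va0 vb0 (ptw w).
have := lee_sum5 core.
rewrite ![\sum_(i : W) _%:E]sumEFin !sumW => le_sum.
have {}le_E1 : \sum_(w : W) \int[jointm Q N]_p (e1 w p + e2 w p)%R%:E <= (E1 + E2)%:E.
  rewrite (eq_bigr (fun w => \int[jointm Q N]_p (e1 w p)%:E +
      \int[lam]_z (pZ w z * x w z)%R%:E)); last first.
    move=> w _; rewrite (ge0_integralD_EFin _ (e10 w) (e20 w) (me1 w) (me2 w)).
    by congr (_ + _); exact: (integral_joint_out2 (mX w) s10 s20 (x0 w) (mx w) (pZE w)).
  by rewrite sum_adde EFinD; exact: leeD.
have le_err : \sum_(w : W) (ln m)%:E * \int[lam]_y (pY w y * (dec y != w)%:R)%R%:E <=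
    (ln m * (M * eps))%:E.
  rewrite -ge0_sume_distrr; last first.
    move=> w _; apply: integral_ge0 => y _; rewrite lee_fin.
    apply: mulr_ge0; last exact: ler0n.
    apply: ltW; exact: (mixture_gt0 (randmT Q1 Q2) (mX w) s10
      (fun y => out_densE Q1 Q2 menc1 menc2 w y s10)).
  by rewrite EFinM; apply: lee_wpmul2l; rewrite ?lee_fin.
(* The finite term M N is restored on both sides: [le_sum] has it on the left, and the two quadratic
   forms yield it on the right. *)
rewrite -(@leeD2rE _ (M * N%:R)%:E)//; apply: le_trans le_sum _.
apply: le_trans (leeD (leeD (leeD (leeD (lexx _) le_err)
  (quad_sum va0 mxi le_va xiV)) (quad_sum vb0 mze le_vb zeV)) le_E1) _.
rewrite -!EFinD lee_fin le_eqVlt; apply/orP; left; apply/eqP.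
by field.
Qed.


Let sum_pZ z : R := \sum_(w : W) pZ w z.

Let sum_pZ_ge w z : (pZ w z <= sum_pZ z)%R.
Proof.
rewrite /sum_pZ (bigD1 w)//= lerDl; apply: sumr_ge0 => v _; exact: ltW.
Qed.

Let sum_pZ_gt0 z : (0 < sum_pZ z)%R.
Proof. exact: lt_le_trans (pZ_gt0 (Ordinal M10, Ordinal M20) z) (sum_pZ_ge _ z). Qed.

Let measurable_sum_pZ : measurable_fun setT sum_pZ.
Proof. by apply: measurable_sum => w; exact: measurable_pZ. Qed.

(** Minus the natural logarithm of the wiretapper's posterior probability of [w]; the uniform prior
    has cancelled. *)
Definition surprisal (w : W) (z : Y) : R := ln (sum_pZ z / pZ w z).

Let measurable_ratio w : measurable_fun setT (fun z => sum_pZ z / pZ w z)%R.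
Proof.
apply: measurable_funM => //.
by apply: measurable_inv_gt0 => //; exact: pZ_gt0.
Qed.

Lemma measurable_surprisal w : measurable_fun setT (surprisal w).
Proof. exact: measurableT_comp (@measurable_ln R) (measurable_ratio w). Qed.

Lemma surprisal_ge0 w z : (0 <= surprisal w z)%R.
Proof. by rewrite /surprisal ln_ge0// ler_pdivlMr// mul1r. Qed.

(** If Y is Gaussian of variance [q] and Z is Y plus noise of variance s2, then [resid q] is the
    variance of Y given Z and [gain q] the regression coefficient of Y on Z. *)
Definition resid (q : R) : R := (q * s2 / (q + s2))%R.
Definition gain (q : R) : R := (q / (q + s2))%R.

Let resid_gt0 q : (0 < q -> 0 < resid q)%R.
Proof. by move=> q0; rewrite /resid divr_gt0 ?mulr_gt0 ?addr_gt0. Qed.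

(** The least-squares error of Y given Z, split into the shares of the first noise, the second noise
    and an input of power P. *)
Let residE P : (0 <= P)%R -> ((1 - gain (s1 + P)) ^+ 2 * s1 + (- gain (s1 + P)) ^+ 2 * s2 +
  (1 - gain (s1 + P)) ^+ 2 * P = resid (s1 + P))%R.
Proof.
move=> P0; rewrite /gain /resid; field.
by rewrite gt_eqF// addr_gt0// ltr_wpDr.
Qed.

Let resid_le P v : (0 <= P)%R -> (s1 + s2 <= v)%R ->
  (s1 * s2 <= resid (s1 + P) * v)%R.
Proof.
move=> P0 sv; have q0 : (0 < s1 + P)%R by rewrite ltr_wpDr.
have h1 : (0 <= P * s2 * s2)%R by rewrite !mulr_ge0// ltW.
have h2 : (0 <= (s1 + P) * s2 * (v - (s1 + s2)))%R.
  by apply: mulr_ge0; [apply: mulr_ge0; exact: ltW|rewrite subr_ge0].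
have d0 : (0 < s1 + P + s2)%R by rewrite addr_gt0.
rewrite /resid mulrAC (ler_pdivlMr _ _ d0) -subr_ge0.
rewrite (_ : _ - _ = P * s2 * s2 + (s1 + P) * s2 * (v - (s1 + s2)))%R; last by ring.
exact: addr_ge0.
Qed.

Let scaled_sum (c V : R) (f : W -> O -> 'I_N -> R) :
  (forall w i, measurable_fun setT (fun u => f w u i)) ->
  \sum_(w : W) \int[Q]_u (\sum_(i < N) f w u i ^+ 2)%R%:E <= (M * (N%:R * V))%R%:E ->
  \sum_(w : W) \int[Q]_u (\sum_(i < N) (c * f w u i) ^+ 2)%R%:E <=
  (M * (N%:R * (c ^+ 2 * V)))%R%:E.
Proof.
move=> mf le_f; have f0 w u : (0 <= \sum_(i < N) f w u i ^+ 2)%R.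
  by apply: sumr_ge0 => i _; exact: sqr_ge0.
rewrite (eq_bigr (fun w => (c ^+ 2)%:E * \int[Q]_u (\sum_(i < N) f w u i ^+ 2)%R%:E)).
  rewrite -ge0_sume_distrr; last first.
    by move=> w _; apply: integral_ge0 => u _; rewrite lee_fin.
  apply: le_trans (lee_wpmul2l _ le_f) _; first by rewrite lee_fin sqr_ge0.
  by rewrite -EFinM lee_fin le_eqVlt; apply/orP; left; apply/eqP; ring.
move=> w _; rewrite -ge0_integralZ_EFin ?sqr_ge0//.
  apply: eq_integral => u _; congr EFin; rewrite mulr_sumr.
  by apply: eq_bigr => i _; rewrite exprMn.
by apply: measurable_sum => i; exact: measurable_funX.
Qed.

Let M_ge1 : (1 <= M)%R.
Proof. by rewrite -natrM ler1n muln_gt0 M10. Qed.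

Let measurable_posterior v (a : R) (c : 'I_N -> R) :
  measurable_fun setT (fun q : Y * Y => gdensN v (fun i => q.1 i - (c i + a * (q.2 i - c i)))%R).
Proof.
have m1 i : measurable_fun setT (fun q : Y * Y => q.1 i).
  exact: measurableT_comp (measurable_coord i) (@measurable_fst _ _ _ _).
have m2 i : measurable_fun setT (fun q : Y * Y => q.2 i).
  exact: measurableT_comp (measurable_coord i) (@measurable_snd _ _ _ _).
apply: measurable_gdensN => i; apply: measurable_funB => //.
apply: measurable_funD => //; apply: measurable_funM => //.
exact: measurable_funB.
Qed.

(** Up to Fano's term, H(W given Z) is at most I(X; Y given Z). The Z-factor of the reference is the
    true channel density, so that averaging over the randomness gives [pZ] and cancels the
    posterior's denominator. *)
Lemma sum_secrecy_bound :
  \sum_(w : W) \int[lam]_z (pZ w z * surprisal w z)%R%:E <=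
  (M * (N%:R * (2^-1 * ln (resid (s1 + (P1 + P2)) * (s1 + s2) / (s1 * s2))) + 0 +
    ln M * eps) + (2 * M + 0))%R%:E.
Proof.
have [mu le_mu] := power_centered menc1 menc2 power1 power2 M20.
have P0 : (0 <= P1 + P2)%R by rewrite addr_ge0// ltW.
set q := (s1 + (P1 + P2))%R; have q0 : (0 < q)%R by rewrite ltr_wpDr.
have mXmu w i : measurable_fun setT (fun u => X w u i - mu i)%R.
  exact: measurable_funB.
(* With these coefficients the two forms are y - (mu + gain q * (z - mu)) and z - x. Subtracting
   [mu] makes P1 + P2 a valid power bound although the inputs may have nonzero means. *)
apply: (@converse (fun w z => sum_pZ z / pZ w z)%R surprisal (fun _ _ => 0%R) M 0
  (resid q) (s1 + s2) (1 - gain q) (- gain q) 1 1 ((1 - gain q) ^+ 2 * (P1 + P2)) 0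
  (2 * M) 0 (fun w u i => (1 - gain q) * (X w u i - mu i))%R (fun _ _ _ => 0%R)) => //.
- exact: resid_gt0.
- exact: resid_le.
- by move=> w z; rewrite divr_gt0.
- exact: surprisal_ge0.
- exact: measurable_surprisal.
- by move=> w z; rewrite /surprisal !addr0.
- by move=> w i; exact: measurable_funM.
- by rewrite residE.
- by rewrite expr1n !mul1r addr0.
- exact: (@scaled_sum _ _ (fun w u i => X w u i - mu i)%R).
- rewrite big1 ?mulr0// => w _; rewrite -[RHS](@integral0 _ _ _ Q setT).
  by apply: eq_integral => u _; rewrite big1// => i _; rewrite expr0n.
- rewrite -cardW.
  pose k (p : Y * Y) := gdensN (resid q) (fun i => p.1 i - (mu i + gain q * (p.2 i - mu i)))%R.
  have k0 p : (0 <= k p)%R by exact: gdensN_ge0.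
  have mk : measurable_fun setT k by exact: measurable_posterior.
  have k1 z : \int[lam]_y (k (y, z))%:E = 1.
    exact: (integral_gdensN (fun i => mu i + gain q * (z i - mu i))%R (resid_gt0 q0)).
  have w0 (w : W) (y : Y) : (0 <= weight (dec y == w) #|{: W}|%:R)%R.
    by rewrite ltW// weight_gt0// cardW.
  have w2 y : (\sum_(w : W) weight (dec y == w) #|{: W}|%:R <= 2)%R.
    by apply: sum_weight_le2 => i j /eqP <- /eqP.
  apply: le_trans (sum_mixture_le (randmT Q1 Q2) mX s0 pZE w0
    (fun w => measurable_weight w _) w2 k0 mk k1).
  apply: lee_sum => w _; rewrite integral_prodm.
  + rewrite le_eqVlt; apply/orP; left; apply/eqP.
    apply: eq_integral => u _; apply: eq_integral => p _; congr EFin.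
    rewrite -!mulrA; congr (_ * _)%R; rewrite !mulrA -!mulrA; congr (_ * (_ * _))%R.
    rewrite /refdens mulrC; congr (_ * _)%R; apply: eq_bigr => i _ /=.
      by congr gdens; ring.
    by congr gdens; ring.
  + move=> p; rewrite lee_fin mulr_ge0 ?refdens_ge0// mulr_ge0//.
    by rewrite divr_ge0// ltW.
  + apply/measurable_EFinP; apply: measurable_funM.
      apply: measurable_funM; first exact: (measurable_out1 (measurable_weight w _)).
      exact: (measurable_out2 (measurable_ratio w)).
    apply: measurable_refdens => i; last exact: measurable_cst.
    exact: measurable_funM.
- rewrite big1// => w _; rewrite -[RHS](@integral0 _ _ _ lam setT).
  by apply: eq_integral => z _; rewrite mulr0.
Qed.

(** Message and randomness of user 1 are frozen, and [sum_mixture_le] is applied to user 2 alone,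
    whence weights with [M2]. The Y-factor is centred at the estimate from Z and the input of user
    1. [ctr] is the centre of the Z-factor: the input of user 1 for reliability, that of user 2 for
    secrecy. *)
Let inner_bound (va vb a : R) (ze : W -> O -> 'I_N -> R) (g : W -> Y -> R)
    (ctr : 'I_M1 -> O1 -> 'I_M2 -> O2 -> 'I_N -> R) :
  (0 < va)%R -> (0 < vb)%R ->
  (forall w u i, X w u i - ze w u i = ctr w.1 u.1 w.2 u.2 i)%R ->
  (forall w1 u1 w2 i, measurable_fun setT (fun u2 => ctr w1 u1 w2 u2 i)) ->
  (forall w i, measurable_fun setT (fun u => ze w u i)) ->
  (forall w z, 0 < g w z)%R -> (forall w, measurable_fun setT (g w)) ->
  (forall w1 u1, exists r : 'I_M2 -> Y -> R,
    (forall j z, (r j z)%:E =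
       \int[Q2]_u (gdensN vb (fun i => z i - ctr w1 u1 j u i)%R)%:E) /\
    forall w2 z, g (w1, w2) z = ((\sum_l r l z) / r w2 z)%R) ->
  \sum_(w : W) \int[jointm Q N]_p (weight (dec p.2.1 == w) M2%:R * g w p.2.2 *
     refdens va vb (1 - a) (- a) 1 1 (fun u i => (1 - a) * enc2 w.2 u.2 i)%R (ze w) w p)%R%:E
  <= (2 * M)%R%:E.
Proof.
move=> va0 vb0 zeE mctr mze g0 mg gr.
pose F (w : W) (p : O * (Y * Y)) : R := (weight (dec p.2.1 == w) M2%:R * g w p.2.2 *
     refdens va vb (1 - a) (- a) 1 1 (fun u i => (1 - a) * enc2 w.2 u.2 i)%R (ze w) w p)%R.
have F0 w p : 0 <= (F w p)%:E.
  rewrite lee_fin; apply: mulr_ge0; last exact: refdens_ge0.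
  by apply: mulr_ge0; apply: ltW => //; exact: weight_gt0.
have mF w : measurable_fun setT (fun p => (F w p)%:E).
  apply/measurable_EFinP; apply: measurable_funM.
    apply: measurable_funM; first exact: (measurable_out1 (measurable_weight w _)).
    exact: (measurable_out2 (mg w)).
  apply: measurable_refdens => // i; apply: measurable_funM => //.
  exact: (measurable_enc2 menc2).
pose G w1 w2 u1 := \int[Q2]_u2 \int[lam2]_q (F (w1, w2) ((u1, u2), q))%:E.
have mG1 w : measurable_fun setT (fun u => \int[lam2]_q (F w (u, q))%:E).
  exact: (measurable_integral_fst lam2 (F0 w) (mF w)).
have mG10 w u : 0 <= \int[lam2]_q (F w (u, q))%:E.
  by apply: integral_ge0 => q _; exact: F0.
have mG w1 w2 : measurable_fun setT (G w1 w2).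
  exact: (measurable_integral_fst Q2 (mG10 (w1, w2)) (mG1 (w1, w2))).
have G0 w1 w2 u1 : 0 <= G w1 w2 u1 by apply: integral_ge0 => u2 _; exact: mG10.
have -> : \sum_(w : W) \int[jointm Q N]_p (F w p)%:E =
    \sum_(w1 < M1) \sum_(w2 < M2) \int[jointm Q N]_p (F (w1, w2) p)%:E.
  by rewrite pair_bigA; apply: eq_bigr => -[].
apply: (@le_trans _ _ (\sum_(w1 < M1) (2 * M2%:R)%:E)); last first.
  by rewrite sume_const_ord -EFinM lee_fin le_eqVlt; apply/orP; left; apply/eqP; ring.
apply: lee_sum => w1 _.
rewrite (eq_bigr (fun w2 => \int[Q1]_u1 G w1 w2 u1)); last first.
  move=> w2 _; rewrite (integral_prodm _ _ (F0 (w1, w2)) (mF (w1, w2))).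
  exact: (integral_prodm _ _ (mG10 (w1, w2)) (mG1 (w1, w2))).
rewrite -ge0_integral_sum//.
apply: (@le_trans _ _ (\int[Q1]_u1 (2 * M2%:R)%:E)); last first.
  by rewrite integral_cst//= probability_setT mule1.
apply: ge0_le_integral => //.
- by move=> u1 _; apply: sume_ge0.
- exact: emeasurable_sum.
move=> u1 _; have [r [rE gE]] := gr w1 u1.
pose k (p : Y * Y) := gdensN va
  (fun i => p.1 i - (enc1 w1 u1 i + a * (p.2 i - enc1 w1 u1 i)))%R.
have k0 p : (0 <= k p)%R by exact: gdensN_ge0.
have mk : measurable_fun setT k by exact: measurable_posterior.
have k1 z : \int[lam]_y (k (y, z))%:E = 1.
  exact: (integral_gdensN (fun i => enc1 w1 u1 i + a * (z i - enc1 w1 u1 i))%R va0).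
have c2 : #|'I_M2|%:R = M2%:R :> R by rewrite card_ord.
have w0 (j : 'I_M2) (y : Y) : (0 <= weight (dec y == (w1, j)) #|'I_M2|%:R)%R.
  by rewrite ltW// weight_gt0// c2.
have w2 y : (\sum_(j < M2) weight (dec y == (w1, j)) #|'I_M2|%:R <= 2)%R.
  by apply: sum_weight_le2 => i j /eqP -> /eqP [].
rewrite -c2; apply: le_trans (sum_mixture_le (probability_setT Q2) (mctr w1 u1) vb0 rE w0
  (fun j => measurable_weight (w1, j) _) w2 k0 mk k1).
apply: lee_sum => j _; rewrite le_eqVlt; apply/orP; left; apply/eqP.
apply: eq_integral => u2 _; apply: eq_integral => p _; congr EFin.
rewrite /F /= gE c2 -!mulrA; congr (_ * _)%R; congr (_ * (_ * _))%R.
rewrite /refdens mulrC; congr (_ * _)%R; apply: eq_bigr => i _ /=; congr gdens.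
  by have := zeE (w1, j) (u1, u2) i => /= <-; ring.
by rewrite /input /=; ring.
Qed.

Let M2_ge1 : (1 <= M2%:R :> R)%R. Proof. by rewrite ler1n. Qed.

(** The reference is the law of (Y, Z) given the input of user 1, with user 2 replaced by Gaussian
    noise of power P2. Its two variances multiply to (s1 + P2) * s2, so the bound is the single-user
    one, 1 + P2 / s1 inside the logarithm. *)
Lemma reliability_bound :
  (M * ln M2%:R)%R%:E <=
  (M * (N%:R * (2^-1 * ln (resid (s1 + P2) * (s1 + s2 + P2) / (s1 * s2))) + 0 +
    ln M2%:R * eps) + (2 * M + 0))%R%:E.
Proof.
have P0 : (0 <= P2)%R by exact: ltW.
set q := (s1 + P2)%R; have q0 : (0 < q)%R by rewrite ltr_wpDr.
have vb0 : (0 < s1 + s2 + P2)%R by rewrite ltr_wpDr.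
have -> : (M * ln M2%:R)%R%:E = \sum_(w : W) \int[lam]_z (pZ w z * ln M2%:R)%R%:E.
  rewrite (eq_bigr (fun=> (ln M2%:R)%:E)); first by rewrite sumEFin sumW.
  move=> w _; rewrite ge0_integralZr_EFin ?ln_ge0//; last by move=> z; exact: ltW.
  by rewrite (integral_mixture1 (randmT Q1 Q2) (mX w) s0 (pZE w)) mul1e.
apply: (@converse (fun _ _ => M2%:R) (fun _ _ => ln M2%:R) (fun _ _ => 0%R) M2%:R 0
  (resid q) (s1 + s2 + P2) (1 - gain q) (- gain q) 1 1 ((1 - gain q) ^+ 2 * P2) P2
  (2 * M) 0 (fun w u i => (1 - gain q) * enc2 w.2 u.2 i)%R
  (fun w u i => enc2 w.2 u.2 i)) => //.
- exact: resid_gt0.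
- by apply: resid_le => //; rewrite lerDl.
- by move=> w z; exact: ln_ge0.
- by move=> w z; rewrite !addr0.
- by move=> w i; apply: measurable_funM => //; exact: (measurable_enc2 menc2).
- by move=> w i; exact: (measurable_enc2 menc2).
- by rewrite residE.
- by rewrite expr1n !mul1r.
- apply: (@scaled_sum _ _ (fun w u i => enc2 w.2 u.2 i)%R).
    by move=> w i; exact: (measurable_enc2 menc2).
  exact: power2_pair.
- exact: power2_pair.
- apply: (@inner_bound (resid q) (s1 + s2 + P2) (gain q)
    (fun w u i => enc2 w.2 u.2 i) (fun _ _ => M2%:R) (fun w1 u1 _ _ i => enc1 w1 u1 i)) => //.
  + exact: resid_gt0.
  + by move=> w u i; rewrite /input addrK.
  + by move=> w i; exact: (measurable_enc2 menc2).
  (* The Z-factor is the same for every message of user 2, so the reciprocal posterior is the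
     constant [M2]. *)
  + move=> w1 u1; exists (fun _ z => gdensN (s1 + s2 + P2) (fun i => z i - enc1 w1 u1 i)%R).
    split=> [j z|w2 z]; first by rewrite integral_cst//= probability_setT mule1.
    by rewrite sumr_const card_ord -[in RHS]mulr_natl mulfK// gt_eqF// gdensN_gt0.
- rewrite big1// => w _; rewrite -[RHS](@integral0 _ _ _ lam setT).
  by apply: eq_integral => z _; rewrite mulr0.
Qed.

(** The reference pairs Y given Z and the input of user 1 with Z given the input of user 2, the
    signal of user 1 counting as Gaussian noise of power P1 in the second factor. It need not be the
    law of any channel; only its mass after weighting matters. *)
Lemma secrecy_bound :
  \sum_(w : W) \int[lam]_z (pZ w z * surprisal w z)%R%:E <=
  (M * (N%:R * (2^-1 * ln (resid (s1 + P2) * (s1 + s2 + P1) / (s1 * s2))) + ln M1%:R +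
    ln M2%:R * eps) + (2 * M + M))%R%:E.
Proof.
have P0 : (0 <= P2)%R by exact: ltW.
have P10' : (0 <= P1)%R by exact: ltW.
set q := (s1 + P2)%R; have q0 : (0 < q)%R by rewrite ltr_wpDr.
set vb := (s1 + s2 + P1)%R; have vb0 : (0 < vb)%R by rewrite ltr_wpDr.
(* The density of Z for message [j] of user 2 when user 1 sends Gaussian noise of power P1. *)
pose r (j : 'I_M2) (z : Y) :=
  Rintegral Q2 setT (fun u => gdensN vb (fun i => z i - enc2 j u i)%R).
have rE j z : (r j z)%:E = \int[Q2]_u (gdensN vb (fun i => z i - enc2 j u i)%R)%:E.
  apply: (Rintegral_bounded Q2 (C := (Num.sqrt (pi * vb *+ 2))^-1 ^+ N) _ _ _).1.
  - by move=> u; exact: gdensN_ge0.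
  - by move=> u; exact: gdensN_le.
  - by apply: measurable_gdensN => i; exact: measurable_funB.
have r0 j z : (0 < r j z)%R.
  exact: (mixture_gt0 (probability_setT Q2) (menc2 j) vb0 (rE j)).
have mr j : measurable_fun setT (r j) by exact: (measurable_mixture (menc2 j) (rE j)).
pose S z := (\sum_j r j z)%R.
have S0 z : (0 < S z)%R.
  apply: lt_le_trans (r0 (Ordinal M20) z) _.
  by rewrite /S (bigD1 (Ordinal M20))//= lerDl; apply: sumr_ge0 => j _; exact: ltW.
have mS : measurable_fun setT S by apply: measurable_sum.
have mg (w : W) : measurable_fun setT (fun z => S z / r w.2 z)%R.
  by apply: measurable_funM => //; exact: measurable_inv_gt0.
(* The ratio of the mismatched posterior r / (M1 S) to the true one. Hence the surprisal is ln (S /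
   r) + ln M1 + ln x, and ln x <= x - 1 <= x. *)
pose x (w : W) z := (sum_pZ z * r w.2 z / (M1%:R * pZ w z * S z))%R.
have x0 w z : (0 < x w z)%R by rewrite /x divr_gt0// !mulr_gt0.
have mx w : measurable_fun setT (x w).
  apply: measurable_funM; first exact: measurable_funM.
  apply: measurable_inv_gt0 => [z|]; first by rewrite !mulr_gt0.
  by apply: measurable_funM => //; exact: measurable_funM.
apply: (@converse (fun w z => S z / r w.2 z)%R surprisal x M2%:R (ln M1%:R)
  (resid q) vb (1 - gain q) (- gain q) 1 1 ((1 - gain q) ^+ 2 * P2) P1
  (2 * M) M (fun w u i => (1 - gain q) * enc2 w.2 u.2 i)%R
  (fun w u i => enc1 w.1 u.1 i)) => //.
- by rewrite ln_ge0// ler1n.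
- exact: resid_gt0.
- by apply: resid_le => //; rewrite lerDl.
- by move=> w z; rewrite divr_gt0.
- exact: surprisal_ge0.
- exact: measurable_surprisal.
- by move=> w z; exact: ltW.
- move=> w z; rewrite /surprisal.
  have -> : (sum_pZ z / pZ w z = S z / r w.2 z * M1%:R * x w z)%R.
    by rewrite /x; field; rewrite !gt_eqF.
  have lnM3 (a b c : R) : (0 < a)%R -> (0 < b)%R -> (0 < c)%R ->
      ln (a * b * c)%R = (ln a + ln b + ln c)%R.
    move=> a0 b0 c0; have ab0 : (0 < a * b)%R by exact: mulr_gt0.
    by rewrite (lnM ab0 c0) (lnM a0 b0).
  rewrite (lnM3 _ _ _ _ m10 (x0 w z)); last by rewrite divr_gt0.
  rewrite lerD2l; apply: le_trans (ln_le_subr1 (x0 w z)) _.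
  by rewrite gerBl.
- by move=> w i; apply: measurable_funM => //; exact: (measurable_enc2 menc2).
- by move=> w i; exact: (measurable_enc1 menc1).
- by rewrite residE.
- by rewrite expr1n !mul1r.
- apply: (@scaled_sum _ _ (fun w u i => enc2 w.2 u.2 i)%R).
    by move=> w i; exact: (measurable_enc2 menc2).
  exact: power2_pair.
- exact: power1_pair.
- apply: (@inner_bound (resid q) vb (gain q) (fun w u i => enc1 w.1 u.1 i)
    (fun w z => S z / r w.2 z)%R (fun w1 u1 w2 u2 i => enc2 w2 u2 i)) => //.
  + exact: resid_gt0.
  + by move=> w u i; rewrite /input addrAC subrr add0r.
  + by move=> w i; exact: (measurable_enc1 menc1).
  + by move=> w z; rewrite divr_gt0.
  + by move=> w1 u1; exists r.
(* Weighted by [pZ], the ratio [x] becomes [sum_pZ] times the mismatched posterior, which sums to 1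
   over the messages; the mass is therefore that of [sum_pZ], namely M. *)
- rewrite -ge0_integral_sum//; last 2 first.
  + by move=> w; apply/measurable_EFinP; exact: measurable_funM.
  + by move=> w z _; rewrite lee_fin mulr_ge0// ltW.
  rewrite -cardW -(integral_sum_mixture (randmT Q1 Q2) mX s0 pZE).
  rewrite le_eqVlt; apply/orP; left; apply/eqP; apply: eq_integral => z _.
  rewrite sumEFin; congr EFin; rewrite -/(sum_pZ z).
  rewrite (eq_bigr (fun w : W => sum_pZ z / (M1%:R * S z) * r w.2 z))%R; last first.
    by move=> w _; rewrite /x; field; rewrite !gt_eqF.
  rewrite -(pair_bigA _ (fun w1 w2 => sum_pZ z / (M1%:R * S z) * r w2 z))%R/=.
  rewrite (eq_bigr (fun=> sum_pZ z / M1%:R))%R; last first.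
    by move=> w1 _; rewrite -mulr_sumr -/(S z); field; rewrite !gt_eqF.
  by rewrite sumr_const card_ord -mulr_natl; field; rewrite gt_eqF.
Qed.

End Converse.

Lemma ler_of_small_slack {R : realType} (A c K : R) : 0 <= K ->
  (forall eps, 0 < eps -> A <= c + eps * K) -> A <= c.
Proof.
move=> K0 h; apply/ler_addgt0Pr => e e0; have K1 : 0 < K + 1 by lra.
apply: le_trans (h (e / (K + 1)) (divr_gt0 e0 K1)) _.
rewrite lerD2l mulrAC ler_pdivrMr// ler_wpM2l ?ltW//; lra.
Qed.

Lemma ln2_gt0 {R : realType} : 0 < ln (2 : R).
Proof. by rewrite ln_gt0// ltr1n. Qed.

(** * From codes to rates, exchange of users and the limit of large N *)

Section Rates.
Context {R : realType}.
Implicit Types P s r eps : R.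

Lemma log2_posterior (I : finType) (p : I -> R) (c : R) w : 0 < c ->
  (forall v, 0 < p v) ->
  - log2 (c * p w / (c * \sum_v p v)) = (ln 2)^-1 * ln ((\sum_v p v) / p w).
Proof.
move=> c0 p0; have S0 : 0 < \sum_v p v.
  by rewrite (bigD1 w)//= ltr_pwDl// sumr_ge0// => v _; exact: ltW.
have -> : c * p w / (c * \sum_v p v) = ((\sum_v p v) / p w)^-1.
  by field; rewrite !gt_eqF.
by rewrite /log2 lnV ?posrE ?divr_gt0// mulNr opprK mulrC.
Qed.

Lemma sum_lebN_le (I : finType) N (f : I -> Rn N -> R) (c K : R) : 0 <= c ->
  (forall w z, 0 <= f w z) -> (forall w, measurable_fun setT (f w)) ->
  (\sum_w \int[lebesgue_n N]_z (f w z)%:E <= K%:E)%E ->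
  \sum_w lebN (fun z => c * f w z) <= c * K.
Proof.
move=> c0 f0 mf hK.
have i0 w : (0 <= \int[lebesgue_n N]_z (f w z)%:E)%E.
  by apply: integral_ge0 => z _; rewrite lee_fin.
have ifin w : (\int[lebesgue_n N]_z (f w z)%:E < +oo)%E.
  apply: le_lt_trans (ltry K); apply: le_trans hK.
  by rewrite (bigD1 w)//= leeDl// sume_ge0.
have fE w : (lebN (fun z => c * f w z))%:E =
    (c%:E * \int[lebesgue_n N]_z (f w z)%:E)%E.
  have e : (\int[lebesgue_n N]_z (c * f w z)%:E =
      c%:E * \int[lebesgue_n N]_z (f w z)%:E)%E by rewrite ge0_integralZ_EFin.
  rewrite lebN_lebesgue; [exact: e|by move=> z; exact: mulr_ge0| |].
    exact: (measurable_funM (measurable_cst c) (mf w)).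
  rewrite e; have /fineK <- : (\int[lebesgue_n N]_z (f w z)%:E)%E \is a fin_num.
    by rewrite ge0_fin_numE.
  by rewrite -EFinM ltry.
rewrite -lee_fin -sumEFin (eq_bigr _ (fun w _ => fE w)) -ge0_sume_distrr//.
by rewrite EFinM; apply: lee_wpmul2l; rewrite ?lee_fin.
Qed.

Lemma out_dens_swap N M1 M2 {d1 d2 : measure_display}
  {O1 : measurableType d1} {O2 : measurableType d2}
  (Q1 : probability O1 R) (Q2 : probability O2 R)
  (enc1 : 'I_M1 -> O1 -> 'I_N -> R) (enc2 : 'I_M2 -> O2 -> 'I_N -> R)
  (v : R) w1 w2 (y : Rn N) :
  (forall w i, measurable_fun setT (fun u => enc1 w u i)) ->
  (forall w i, measurable_fun setT (fun u => enc2 w u i)) -> 0 < v ->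
  out_dens Q2 Q1 enc2 enc1 v w2 w1 y = out_dens Q1 Q2 enc1 enc2 v w1 w2 y.
Proof.
move=> m1 m2 v0; apply: EFin_inj.
have := out_densE Q1 Q2 m1 m2 (w1, w2) y v0; rewrite /= => ->.
have := out_densE Q2 Q1 m2 m1 (w2, w1) y v0; rewrite /= => ->.
rewrite /randm integral_prodm_swap; last 2 first.
- by move=> u; rewrite lee_fin gdensN_ge0.
- apply/measurable_EFinP; apply: measurable_gdensN => i.
  by apply: measurable_funB => //; exact: measurable_input.
rewrite integral_prodm; last 2 first.
- by move=> u; rewrite lee_fin gdensN_ge0.
- apply/measurable_EFinP; apply: measurable_gdensN => i.
  by apply: measurable_funB => //; exact: measurable_input.
apply: eq_integral => u1 _; apply: eq_integral => u2 _; congr EFin.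
by apply: eq_bigr => i _; rewrite /input /= (addrC (enc1 _ _ _)).
Qed.

Lemma good_code_swap P1 P2 s1 s2 r1 r2 eps N M1 M2 {d1 d2 : measure_display}
  {O1 : measurableType d1} {O2 : measurableType d2}
  (Q1 : probability O1 R) (Q2 : probability O2 R)
  (enc1 : 'I_M1 -> O1 -> 'I_N -> R) (enc2 : 'I_M2 -> O2 -> 'I_N -> R)
  (dec : ('I_N -> R) -> 'I_M1 * 'I_M2) : 0 < s1 -> 0 < s2 ->
  good_code P1 P2 s1 s2 r1 r2 eps Q1 Q2 enc1 enc2 dec ->
  good_code P2 P1 s1 s2 r2 r1 eps Q2 Q1 enc2 enc1 (fun y => ((dec y).2, (dec y).1)).
Proof.
move=> s10 s20; cbv beta delta [good_code] zeta.
move=> -[[M10 [M20 [rE1 rE2]]] [m1 [m2 mdec]] [pow1 pow2] err sec].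
have s0 : 0 < s1 + s2 by rewrite addr_gt0.
have dswap v w1 w2 : 0 < v -> out_dens Q2 Q1 enc2 enc1 v w2 w1 =
    out_dens Q1 Q2 enc1 enc2 v w1 w2.
  by move=> v0; apply/funext => y; exact: out_dens_swap.
split.
- by [].
- split => //; split => // -[w2 w1].
  rewrite (_ : _ @^-1` _ = dec @^-1` [set (w1, w2)]); first exact: mdec.
  apply/seteqP; split => y /=; last by move=> ->.
  by case: (dec y) => a b /= [-> ->].
- by [].
- rewrite mulnC exchange_big/=; apply: le_trans err; rewrite le_eqVlt.
  apply/orP; left; apply/eqP; congr (_ * _); apply: eq_bigr => w1 _.
  apply: eq_bigr => w2 _; congr lebN; apply/funext => y; rewrite dswap//.
  by case: (dec y) => a b /=; rewrite !xpair_eqE andbC.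
- rewrite mulnC (addrC r2); apply: le_trans sec _; rewrite le_eqVlt.
  apply/orP; left; apply/eqP; congr (_ * (_ * _)); rewrite [RHS]exchange_big/=.
  apply: eq_bigr => w1 _; apply: eq_bigr => w2 _; congr lebN; apply/funext => z.
  rewrite dswap//; congr (_ * - log2 (_ / (_ * _))); rewrite [RHS]exchange_big/=.
  by apply: eq_bigr => v1 _; apply: eq_bigr => v2 _; rewrite dswap.
Qed.

(** The converse bounds in nats, divided by M1 M2 N. The constants 2 and 3 are what remains of the
    masses 2 M and 2 M + M. *)
Lemma good_code_bounds P1 P2 s1 s2 r1 r2 eps N M1 M2 {d1 d2 : measure_display}
  {O1 : measurableType d1} {O2 : measurableType d2}
  (Q1 : probability O1 R) (Q2 : probability O2 R)
  (enc1 : 'I_M1 -> O1 -> 'I_N -> R) (enc2 : 'I_M2 -> O2 -> 'I_N -> R)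
  (dec : ('I_N -> R) -> 'I_M1 * 'I_M2) :
  0 < P1 -> 0 < P2 -> 0 < s1 -> 0 < s2 -> (0 < N)%N ->
  good_code P1 P2 s1 s2 r1 r2 eps Q1 Q2 enc1 enc2 dec ->
  [/\ 0 <= r1, 0 <= r2,
    r2 * ln 2 <= 2^-1 * ln (resid s2 (s1 + P2) * (s1 + s2 + P2) / (s1 * s2))
      + r2 * ln 2 * eps + 2 / N%:R,
    (r1 + r2 - eps) * ln 2 <=
      2^-1 * ln (resid s2 (s1 + (P1 + P2)) * (s1 + s2) / (s1 * s2))
      + (r1 + r2) * ln 2 * eps + 2 / N%:R &
    (r1 + r2 - eps) * ln 2 <=
      2^-1 * ln (resid s2 (s1 + P2) * (s1 + s2 + P1) / (s1 * s2))
      + r1 * ln 2 + r2 * ln 2 * eps + 3 / N%:R].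
Proof.
move=> P10 P20 s10 s20 N0; cbv beta delta [good_code] zeta.
move=> -[[M10 [M20 [rE1 rE2]]] [m1 [m2 mdec]] [pow1 pow2] err sec].
have s0 : 0 < s1 + s2 by rewrite addr_gt0.
have l2 := @ln2_gt0 R.
have n0 : 0 < N%:R :> R by rewrite ltr0n.
have m10 : 0 < M1%:R :> R by rewrite ltr0n.
have m20 : 0 < M2%:R :> R by rewrite ltr0n.
have M0 : 0 < M1%:R * M2%:R :> R by rewrite mulr_gt0.
have lnM1 : ln M1%:R = N%:R * (r1 * ln 2) :> R.
  by rewrite -rE1 /log2; field; rewrite !gt_eqF.
have lnM2 : ln M2%:R = N%:R * (r2 * ln 2) :> R.
  by rewrite -rE2 /log2; field; rewrite !gt_eqF.
have rate_ge0 (m : nat) : (0 < m)%N -> 0 <= log2 m%:R / N%:R :> R.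
  by move=> m0; rewrite divr_ge0// divr_ge0 ?(ltW l2)// ln_ge0// ler1n.
have lnM : ln (M1%:R * M2%:R) = N%:R * ((r1 + r2) * ln 2) :> R.
  by rewrite lnM ?posrE// lnM1 lnM2 -mulrDr -mulrDl.
have mX w i := measurable_input m1 m2 w i.
pose pY (w : 'I_M1 * 'I_M2) : Rn N -> R := out_dens Q1 Q2 enc1 enc2 s1 w.1 w.2.
pose pZ (w : 'I_M1 * 'I_M2) : Rn N -> R := out_dens Q1 Q2 enc1 enc2 (s1 + s2) w.1 w.2.
have pYE w y := out_densE Q1 Q2 m1 m2 w y s10.
have pZE w y := out_densE Q1 Q2 m1 m2 w y s0.
have pY0 w y : 0 < pY w y by exact: (mixture_gt0 (randmT Q1 Q2) (mX w) s10 (pYE w)).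
have pZ0 w y : 0 < pZ w y by exact: (mixture_gt0 (randmT Q1 Q2) (mX w) s0 (pZE w)).
have mpY w : measurable_fun setT (pY w) by exact: (measurable_mixture (mX w) (pYE w)).
have mpZ w : measurable_fun setT (pZ w) by exact: (measurable_mixture (mX w) (pZE w)).
have mwrong w : measurable_fun setT (fun y : Rn N => (dec y != w)%:R : R).
  rewrite (_ : (fun y => _) = \1_(~` (dec @^-1` [set w]))).
    by apply: measurable_indic; apply: measurableC; exact: mdec.
  apply/funext => y; rewrite indicE in_setC; congr (_%:R).
  by congr (nat_of_bool (~~ _)); apply/eqP/idP; rewrite inE.
have errE : (\sum_w \int[lebesgue_n N]_y (pY w y * (dec y != w)%:R)%R%:E <=
    (M1%:R * M2%:R * eps)%R%:E)%E.
  have f0 w y : 0 <= pY w y * (dec y != w)%:R by rewrite mulr_ge0// ltW.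
  have mf w : measurable_fun setT (fun y => pY w y * (dec y != w)%:R).
    exact: measurable_funM.
  rewrite (eq_bigr (fun w => (lebN (fun y => pY w y * (dec y != w)%:R))%:E)); last first.
    (* The error integrand is dominated by a probability density, so [lebN] is the true integral. *)
    move=> w _; rewrite lebN_lebesgue//.
    apply: (@le_lt_trans _ _ (\int[lebesgue_n N]_y (pY w y)%:E)%E).
      apply: ge0_le_integral_EFin => // y.
      by rewrite ler_piMr ?(ltW (pY0 w y))//; case: (_ != _).
    by rewrite (integral_mixture1 (randmT Q1 Q2) (mX w) s10 (pYE w)) ltry.
  rewrite sumEFin lee_fin mulrC -ler_pdivrMr// mulrC -natrM.
  apply: le_trans err; rewrite le_eqVlt; apply/orP; left; apply/eqP.
  by rewrite pair_bigA; congr (_ * _); apply: eq_bigr => -[].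
pose sp := surprisal Q1 Q2 enc1 enc2 s1 s2.
have sp0 w z : 0 <= sp w z by exact: surprisal_ge0.
have msp w : measurable_fun setT (sp w) by exact: measurable_surprisal.
have secE (K : R) :
    (\sum_w \int[lebesgue_n N]_z (pZ w z * sp w z)%R%:E <= K%:E)%E ->
    (r1 + r2 - eps) * ln 2 <= K / (M1%:R * M2%:R * N%:R).
  move=> hK.
  have g0 w z : 0 <= pZ w z * sp w z.
    by apply: mulr_ge0; [exact: ltW (pZ0 w z)|exact: sp0].
  have mg w : measurable_fun setT (fun z => pZ w z * sp w z).
    exact: (measurable_funM (mpZ w) (msp w)).
  have l2V : 0 <= (ln 2)^-1 :> R by rewrite invr_ge0 ltW.
  have sumK := sum_lebN_le l2V g0 mg hK.
  have secW : r1 + r2 - eps <= N%:R^-1 * ((M1%:R * M2%:R)^-1 *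
      \sum_w lebN (fun z => (ln 2)^-1 * (pZ w z * sp w z))).
    apply: le_trans sec _; rewrite natrM le_eqVlt; apply/orP; left; apply/eqP.
    congr (_ * (_ * _)); rewrite pair_bigA; apply: eq_bigr => w _.
    congr lebN; apply/funext => z; rewrite [RHS]mulrCA; congr (_ * _).
    rewrite pair_bigA; apply: (@log2_posterior _ (fun v => pZ v z) _ w).
      by rewrite invr_gt0.
    by move=> v; exact: pZ0.
  move: sumK secW; set S := \sum_w _ => sumK secW.
  rewrite -ler_pdivlMr//; apply: le_trans secW _.
  rewrite (_ : K / _ / _ = N%:R^-1 * ((M1%:R * M2%:R)^-1 * ((ln 2)^-1 * K))).
    by rewrite ler_pM2l ?invr_gt0// ler_pM2l ?invr_gt0.
  by field; rewrite !gt_eqF.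
have mdec' w : measurable (dec @^-1` [set w] : set (Rn N)) by exact: mdec.
split.
- by rewrite -rE1; exact: rate_ge0.
- by rewrite -rE2; exact: rate_ge0.
- have := reliability_bound m1 m2 mdec' s10 s20 P20 M10 M20 pow2 errE.
  rewrite lee_fin lnM2 => h; set c := 2^-1 * ln _ in h *.
  rewrite -subr_ge0 (_ : _ - _ = ((M1%:R * M2%:R) * (N%:R * c + 0 +
      N%:R * (r2 * ln 2) * eps) + (2 * (M1%:R * M2%:R) + 0) -
      M1%:R * M2%:R * (N%:R * (r2 * ln 2))) / (M1%:R * M2%:R * N%:R)).
    by rewrite divr_ge0 ?subr_ge0// ltW// mulr_gt0.
  by field; rewrite !gt_eqF.
- have := secE _ (sum_secrecy_bound m1 m2 mdec' s10 s20 P10 P20 M10 M20 pow1 pow2 errE).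
  move/le_trans; apply; rewrite lnM le_eqVlt; apply/orP; left; apply/eqP.
  by field; rewrite !gt_eqF.
- have := secE _ (secrecy_bound m1 m2 mdec' s10 s20 P10 P20 M10 M20 pow1 pow2 errE).
  move/le_trans; apply; rewrite lnM1 lnM2 le_eqVlt; apply/orP; left; apply/eqP.
  by field; rewrite !gt_eqF.
Qed.

Lemma achievable_swap P1 P2 s1 s2 r1 r2 : 0 < s1 -> 0 < s2 ->
  achievable_sgmac P1 P2 s1 s2 r1 r2 -> achievable_sgmac P2 P1 s1 s2 r2 r1.
Proof.
move=> s10 s20 h eps eps0; have [N0 hN] := h eps eps0; exists N0 => N NN0.
have [M1 [M2 [d1 [d2 [T1 [T2 [Q1 [Q2 [e1 [e2 [dec g]]]]]]]]]]] := hN N NN0.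
by do 10 eexists; exists (fun y => ((dec y).2, (dec y).1)); exact: good_code_swap g.
Qed.

Lemma achievable_bounds P1 P2 s1 s2 r1 r2 :
  0 < P1 -> 0 < P2 -> 0 < s1 -> 0 < s2 ->
  achievable_sgmac P1 P2 s1 s2 r1 r2 ->
  [/\ 0 <= r1, 0 <= r2,
    r2 * ln 2 <= 2^-1 * ln (1 + P2 / s1),
    r2 * ln 2 <= 2^-1 * (ln (1 + P2 / s1) - ln ((s1 + s2 + P2) / (s1 + s2 + P1))) &
    (r1 + r2) * ln 2 <=
      2^-1 * (ln (1 + (P1 + P2) / s1) - ln (1 + (P1 + P2) / (s1 + s2)))].
Proof.
move=> P10 P20 s10 s20 h; have l2 := @ln2_gt0 R.
have code eps : 0 < eps -> exists N : nat, [/\ (0 : R) < N%:R, (N%:R^-1 : R) <= eps & [/\ 0 <= r1, 0 <= r2,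
    r2 * ln 2 <= 2^-1 * ln (resid s2 (s1 + P2) * (s1 + s2 + P2) / (s1 * s2))
      + r2 * ln 2 * eps + 2 / N%:R,
    (r1 + r2 - eps) * ln 2 <=
      2^-1 * ln (resid s2 (s1 + (P1 + P2)) * (s1 + s2) / (s1 * s2))
      + (r1 + r2) * ln 2 * eps + 2 / N%:R &
    (r1 + r2 - eps) * ln 2 <=
      2^-1 * ln (resid s2 (s1 + P2) * (s1 + s2 + P1) / (s1 * s2))
      + r1 * ln 2 + r2 * ln 2 * eps + 3 / N%:R]].
  move=> eps0; have [N0 hN] := h eps eps0.
  (* Large enough also for 1/N <= eps, so that every slack term is a constant multiple of [eps]. *)
  pose N := (maxn N0 (Num.truncn eps^-1)).+1; exists N.
  have N0' : 0 < N%:R :> R by rewrite ltr0n.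
  have eN : eps^-1 <= N%:R.
    apply: le_trans (ltW (truncnS_gt _)) _.
    by rewrite ler_nat ltnS leq_maxr.
  have [|M1 [M2 [d1 [d2 [T1 [T2 [Q1 [Q2 [e1 [e2 [dec g]]]]]]]]]]] := hN N.
    by rewrite ltnS leq_maxl.
  split=> //; last exact: good_code_bounds g.
  by rewrite -[leRHS]invrK lef_pV2 ?posrE ?invr_gt0.
have [_ [_ _ [r10 r20 _ _ _]]] := code 1 ltr01.
have k2 : 0 <= r2 * ln 2 by rewrite mulr_ge0// ltW.
have k1 : 0 <= r1 * ln 2 by rewrite mulr_ge0// ltW.
have q2 : 0 < s1 + P2 by rewrite addr_gt0.
have q12 : 0 < s1 + (P1 + P2) by rewrite !addr_gt0.
have t1 : 0 < s1 + s2 + P1 by rewrite !addr_gt0.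
have t2 : 0 < s1 + s2 + P2 by rewrite !addr_gt0.
have s0 : 0 < s1 + s2 by rewrite addr_gt0.
have c1 : 0 < 1 + P2 / s1 by rewrite addr_gt0// divr_gt0.
have P12 : 0 < P1 + P2 by rewrite addr_gt0.
split => //.
- have -> : 1 + P2 / s1 = resid s2 (s1 + P2) * (s1 + s2 + P2) / (s1 * s2).
    by rewrite /resid; field; rewrite !gt_eqF// addr_gt0.
  apply: (@ler_of_small_slack _ _ _ (r2 * ln 2 + 2)) => [|eps eps0]; first by lra.
  by have [N [n0 Ne [_ _ hb _ _]]] := code eps eps0; lra.
- have -> : ln (1 + P2 / s1) - ln ((s1 + s2 + P2) / (s1 + s2 + P1)) =
      ln (resid s2 (s1 + P2) * (s1 + s2 + P1) / (s1 * s2)).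
    rewrite -ln_div ?posrE ?divr_gt0//; congr ln.
    by rewrite /resid; field; rewrite !gt_eqF// addr_gt0.
  (* The full rate charged to user 1 cancels [r1] on the left, leaving a bound on [r2] alone. *)
  apply: (@ler_of_small_slack _ _ _ (ln 2 + r2 * ln 2 + 3)) => [|eps eps0]; first by lra.
  by have [N [n0 Ne [_ _ _ _ hb]]] := code eps eps0; lra.
- have -> : ln (1 + (P1 + P2) / s1) - ln (1 + (P1 + P2) / (s1 + s2)) =
      ln (resid s2 (s1 + (P1 + P2)) * (s1 + s2) / (s1 * s2)).
    rewrite -ln_div ?posrE ?addr_gt0 ?divr_gt0//; congr ln.
    by rewrite /resid; field; rewrite !gt_eqF// !addr_gt0.
  apply: (@ler_of_small_slack _ _ _ (ln 2 + (r1 * ln 2 + r2 * ln 2) + 2)) => [|eps eps0].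
    by lra.
  by have [N [n0 Ne [_ _ _ hb _]]] := code eps eps0; lra.
Qed.

Lemma le_half_log2B (x a b : R) :
  x * ln 2 <= 2^-1 * (a - b) -> x <= 2^-1 * (a / ln 2) - 2^-1 * (b / ln 2).
Proof.
by rewrite -ler_pdivlMr ?ln2_gt0// => /le_trans; apply; rewrite mulrBr mulrBl !mulrA.
Qed.

End Rates.

Theorem theorem2 (R : realType) (P1 P2 s1 s2 : R) :
  0 < P1 -> 0 < P2 -> 0 < s1 -> 0 < s2 ->
  C_sgmac P1 P2 s1 s2 `<=` C_out_sgmac P1 P2 s1 s2.
Proof.
move=> P10 P20 s10 s20 [r1 r2] /= ach.
have [r10 r20 weak2 sec2 sum] := achievable_bounds P10 P20 s10 s20 ach.
have [_ _ weak1 sec1 _] :=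
  achievable_bounds P20 P10 s10 s20 (achievable_swap s10 s20 ach).
have t1 : s1 + s2 + P1 != 0 by rewrite gt_eqF// !addr_gt0.
have t2 : s1 + s2 + P2 != 0 by rewrite gt_eqF// !addr_gt0.
(* Now D = s1 + s2 + max(P1, P2). For the user of larger power the subtracted term is that of the
   secrecy bound; for the other user D equals the denominator, the term vanishes and the single-user
   bound suffices. *)
exists 1, 1, 0; rewrite /= !ler01 !lexx; split => //.
rewrite !mul1r mul0r addr0 /log2; split => //; last exact: le_half_log2B.
- apply: le_half_log2B; case: (leP P1 P2) => _ //.
  by rewrite divff// ln1 subr0.
- apply: le_half_log2B; case: (leP P1 P2) => _ //.
  by rewrite divff// ln1 subr0.
Qed.
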